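(* Let $(q_n)$ and $(a_{n,i})$ be the cutting and spacer parameters for a rank-one transformation $T$ and suppose the cutting and spacer parameters are both bounded. Then $T$ has trivial centralizer if and only if there exists $k\in\mathbb{N}$ such that for all $N\in\mathbb{N}$ there exist $n,m,i,j$ with $N\le n,m<N+k$, $0<i<q_n$ and $0<j<q_m$, such that $a_{n,i}\ne a_{m,j}$.
   Context: $\mathbb{N}=\{0,1,2,\dots\}$. **Rank-one transformations.** Let $q_n>1$ ($n\in\mathbb{N}$) be integers and $a_{n,i}\ge 0$ ($n\in\mathbb{N}$, $0<i<q_n$) integers. Define $h_0=1$, $h_{n+1}=q_nh_n+\sum_{0<i<q_n}a_{n,i}$. An invertible measure preserving transformation $T$ of $[0,1]$ with Lebesgue measure is rank-one with cutting parameter $(q_n)$ and spacer parameter $(a_{n,i})$ if $\sum_n (h_{n+1}-q_nh_n)/h_{n+1}<\infty$ and there are measurable sets $B_n$, $B_{n,i}$ ($0<i\le q_n$), $C_{n,i,j}$ ($0<i<q_n$, $0<j\le a_{n,i}$) such that for all $n$: $\{B_{n,i}:0<i\le q_n\}$ is a partition of $B_n$; the sets $T^k(B_n)$, $0\le k<h_n$, are disjoint; for $0<i<q_n$, $T^{h_n}(B_{n,i})=C_{n,i,1}$ if $a_{n,i}\ne0$ and $T^{h_n}(B_{n,i})=B_{n,i+1}$ if $a_{n,i}=0$; $T(C_{n,i,j})=C_{n,i,j+1}$ if $j<a_{n,i}$; $T(C_{n,i,a_{n,i}})=B_{n,i+1}$ if $i<q_n$ and $a_{n,i}\neq 0$;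 $B_{n+1}=B_{n,1}$; and the finite unions of levels $T^k(B_n)$ ($n\in\mathbb{N}$, $0\le k<h_n$) are dense in the measure algebra. A measure preserving transformation of a Lebesgue space is rank-one, described by these parameters, if it is isomorphic to such a $T$. **Trivial centralizer.** For an invertible measure preserving $T$ on a Lebesgue space $(X,\mu)$, $C(T)=\{S\in\mathrm{Aut}(X,\mu): TS=ST\}$, where $\mathrm{Aut}(X,\mu)$ is the group of invertible measure preserving transformations modulo null sets. $T$ has trivial centralizer if $C(T)=\{T^n:n\in\mathbb{Z}\}$. *)

(* Defs.v *)
From HB Require Import structures.
From mathcomp Require Import all_boot all_order all_algebra.
From mathcomp Require Import all_classical all_reals all_analysis.

Set Implicit Arguments.
Unset Strict Implicit.
Unset Printing Implicit Defensive.

Import Order.TTheory GRing.Theory Num.Theory.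
Import numFieldNormedType.Exports.

Local Open Scope classical_set_scope.
Local Open Scope ring_scope.

Definition unit_interval (R : realType) := {x : R | 0 <= x <= 1}.

HB.instance Definition _ (R : realType) := Choice.on (unit_interval R).

Definition unit_interval0 (R : realType) : unit_interval R :=
  exist _ 0 (introT andP (conj (lexx 0) ler01)).

HB.instance Definition _ (R : realType) :=
  isPointed.Build (unit_interval R) (unit_interval0 R).

Section unit_lebesgue.
Context {R : realType}.
Notation leb := (@completed_lebesgue_measure R).

(* [emb A] is [A] seen as a subset of the real line carrying the sigma-algebra
   of Lebesgue measurable sets. *)
Definition emb (A : set (unit_interval R))
  : set (caratheodory_type (wlength (@idfun R))^*%mu) := val @` A.

Lemma embT : emb setT = `[0, 1]%classic.
Proof.
rewrite /emb eqEsubset; split => [x [[y y01] _ <-]|x x01] /=.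
  by rewrite in_itv.
by move: x01; rewrite /= in_itv /= => x01; exists (exist _ x x01).
Qed.

Lemma emb_bigcup (F : (set (unit_interval R))^nat) :
  emb (\bigcup_i F i) = \bigcup_i emb (F i).
Proof. exact: image_bigcup. Qed.

Lemma embC A : emb (~` A) = emb setT `\` emb A.
Proof.
rewrite eqEsubset; split => [_ [x Ax <-]|_ [[x _ <-] Ax]].
  split; first by exists x.
  by move=> [y Ay /val_inj yx]; apply: Ax; rewrite -yx.
by exists x => // /= xA; apply: Ax; exists x.
Qed.

Definition lebesgue_measurable (A : set (unit_interval R)) :=
  measurable (emb A).

Lemma measurable_embT : lebesgue_measurable setT.
Proof.
rewrite /lebesgue_measurable embT.
apply: sub_caratheodory.
exact: (@measurable_itv R `[0, 1]).
Qed.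

Let m0 : lebesgue_measurable set0.
Proof. by rewrite /lebesgue_measurable /emb image_set0; exact: measurable0. Qed.

Let mC A : lebesgue_measurable A -> lebesgue_measurable (~` A).
Proof.
rewrite /lebesgue_measurable embC => mA.
by apply: measurableD => //; exact: measurable_embT.
Qed.

Let mU (F : (set (unit_interval R))^nat) :
  (forall i, lebesgue_measurable (F i)) -> lebesgue_measurable (\bigcup_i F i).
Proof.
by rewrite /lebesgue_measurable emb_bigcup => mF; exact: bigcupT_measurable.
Qed.

HB.instance Definition _ := @isMeasurable.Build default_measure_display
  (unit_interval R) lebesgue_measurable m0 mC mU.

Definition unit_lebesgue (A : set (unit_interval R)) : \bar R := leb (emb A).

Let ul0 : unit_lebesgue set0 = 0%E.
Proof. by rewrite /unit_lebesgue /emb image_set0 measure0. Qed.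

Let ul_ge0 A : (0 <= unit_lebesgue A)%E.
Proof. exact: measure_ge0. Qed.

Let ul_sigma : semi_sigma_additive unit_lebesgue.
Proof.
move=> F mF tF mUF; rewrite /unit_lebesgue emb_bigcup.
apply: measure_semi_sigma_additive => //.
- apply/trivIsetP => i j _ _ ij; rewrite -subset0 => _ [[x Fx <-] [y Fy]].
  move=> /val_inj yx; rewrite yx in Fy.
  move/trivIsetP : tF => /(_ i j Logic.I Logic.I ij) FF0.
  by have : (F i `&` F j) x by []; rewrite FF0.
- by rewrite -emb_bigcup.
Qed.

HB.instance Definition _ :=
  isMeasure.Build _ _ _ unit_lebesgue ul0 ul_ge0 ul_sigma.

Let ulT : unit_lebesgue setT = 1%E.
Proof.
rewrite /unit_lebesgue embT.
rewrite [LHS](_ : _ = @lebesgue_measure R `[0, 1]%classic) //.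
by rewrite lebesgue_measure_itv /= lte_fin ltr01 oppr0 adde0.
Qed.

HB.instance Definition _ :=
  Measure_isProbability.Build _ _ _ unit_lebesgue ulT.

End unit_lebesgue.
Arguments unit_lebesgue R A : clear implicits.

(* Bijections of the whole space suffice to represent Aut(X, mu): a map that is
   invertible modulo null sets restricts to a bijection of an invariant conull
   measurable set and may be extended by the identity. *)
Record mp_aut d (X : measurableType d) (R : realType)
    (mu : {measure set X -> \bar R}) := MpAut {
  aut_fun :> X -> X ;
  aut_inv : X -> X ;
  aut_funK : cancel aut_fun aut_inv ;
  aut_invK : cancel aut_inv aut_fun ;
  measurable_aut_fun : measurable_fun setT aut_fun ;
  measurable_aut_inv : measurable_fun setT aut_inv ;
  aut_preserving : forall A, measurable A -> mu (aut_fun @^-1` A) = mu A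
}.

Section transformations.
Context {d} {X : measurableType d} {R : realType}.
Variable mu : {measure set X -> \bar R}.
Implicit Types S T : mp_aut mu.

Definition aut_pow T (n : int) : X -> X :=
  match n with
  | Posz m => iter m T
  | Negz m => iter m.+1 (aut_inv T)
  end.

(* Elements of Aut(X, mu) are transformations up to equality almost everywhere:
   [centralizer T] and [powers T] are the sets of all representatives of the
   classes in C(T) and in { T^n : n in Z }. *)
Definition centralizer T : set (mp_aut mu) :=
  [set S | {ae mu, forall x, T (S x) = S (T x)}].

Definition powers T : set (mp_aut mu) :=
  [set S | exists n : int, {ae mu, forall x, S x = aut_pow T n x}].

Definition trivial_centralizer T := centralizer T = powers T.

End transformations.

Section isomorphism.
Context {d d'} {X : measurableType d} {Y : measurableType d'} {R : realType}.
Variables (mu : {measure set X -> \bar R}) (nu : {measure set Y -> \bar R}).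

Record iso_mod0 (X0 : set X) (Y0 : set Y) (phi : X -> Y) : Prop := IsoMod0 {
  iso_dom : measurable X0 /\ mu (~` X0) = 0%E ;
  iso_codom : measurable Y0 /\ nu (~` Y0) = 0%E ;
  iso_bij : set_bij X0 Y0 phi ;
  iso_image : forall A, measurable A -> A `<=` X0 -> measurable (phi @` A) ;
  iso_preimage : forall B, measurable B -> B `<=` Y0 ->
    measurable (X0 `&` phi @^-1` B) ;
  iso_measure : forall B, measurable B -> B `<=` Y0 ->
    mu (X0 `&` phi @^-1` B) = nu B
}.

Definition isomorphic (T : mp_aut mu) (S : mp_aut nu) :=
  exists (X0 : set X) (Y0 : set Y) (phi : X -> Y),
    [/\ iso_mod0 X0 Y0 phi, T @` X0 = X0 &
        forall x, X0 x -> phi (T x) = S (phi x)].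

End isomorphism.

Definition lebesgue_space d (X : measurableType d) (R : realType)
    (mu : {measure set X -> \bar R}) :=
  measure_is_complete mu /\
  exists (X0 : set X) (Y0 : set (unit_interval R)) (phi : X -> unit_interval R),
    iso_mod0 mu (unit_lebesgue R) X0 Y0 phi.

(* Only the values [a n i] with [0 < i < q n] are meaningful. *)
Fixpoint height (q : nat -> nat) (a : nat -> nat -> nat) (n : nat) : nat :=
  match n with
  | 0%N => 1%N
  | m.+1 => (q m * height q a m + \sum_(1 <= i < q m) a m i)%N
  end.

Section rank_one.
Context {d} {X : measurableType d} {R : realType}.
Variable mu : {measure set X -> \bar R}.
Implicit Types (T : mp_aut mu) (q : nat -> nat) (a : nat -> nat -> nat).

Definition level T (B : nat -> set X) (n k : nat) : set X := iter k T @` B n.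

Definition levels_dense T q a (B : nat -> set X) :=
  forall A (e : R), measurable A -> 0 < e ->
    exists2 s : seq (nat * nat),
      (forall p, p \in s -> (p.2 < height q a p.1)%N) &
      (mu (A `+` \big[setU/set0]_(p <- s) level T B p.1 p.2) < e%:E)%E.

(* Relations are exact rather than modulo null sets: removing the [T]-orbit of
   a null set from all the sets involved makes almost sure relations exact, and
   [levels_dense] ignores null sets. *)
Record towers T q a (B : nat -> set X) (B' : nat -> nat -> set X)
    (C : nat -> nat -> nat -> set X) : Prop := Towers {
  towers_measB : forall n, measurable (B n) ;
  towers_measB' : forall n i, (0 < i <= q n)%N -> measurable (B' n i) ;
  towers_measC : forall n i j, (0 < i < q n)%N -> (0 < j <= a n i)%N ->
    measurable (C n i j) ;
  towers_partition : forall n,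
    classical_sets.partition [set i | (0 < i <= q n)%N] (B' n) (B n) ;
  towers_disjoint : forall n,
    trivIset [set k | (k < height q a n)%N] (level T B n) ;
  towers_spacer : forall n i, (0 < i < q n)%N -> a n i <> 0%N ->
    iter (height q a n) T @` B' n i = C n i 1%N ;
  towers_nospacer : forall n i, (0 < i < q n)%N -> a n i = 0%N ->
    iter (height q a n) T @` B' n i = B' n i.+1 ;
  towers_next : forall n i j, (0 < i < q n)%N -> (0 < j < a n i)%N ->
    T @` C n i j = C n i j.+1 ;
  towers_last : forall n i, (0 < i < q n)%N -> a n i <> 0%N ->
    T @` C n i (a n i) = B' n i.+1 ;
  towers_base : forall n, B n.+1 = B' n 1%N ;
  towers_dense : levels_dense T q a B
}.

Definition cutting_stacking T q a :=
  [/\ forall n, (1 < q n)%N,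
      (\sum_(0 <= n <oo)
         (((height q a n.+1)%:R - (q n * height q a n)%:R)
            / (height q a n.+1)%:R : R)%:E < +oo)%E &
      exists B B' C, towers T q a B B' C].

End rank_one.

Definition rank_one d (X : measurableType d) (R : realType)
    (mu : {measure set X -> \bar R}) (T : mp_aut mu)
    (q : nat -> nat) (a : nat -> nat -> nat) :=
  exists T0 : mp_aut (unit_lebesgue R),
    cutting_stacking T0 q a /\ isomorphic T T0.

Definition bounded_parameters (q : nat -> nat) (a : nat -> nat -> nat) :=
  (exists M, forall n, (q n <= M)%N) /\
  (exists M, forall n i, (0 < i < q n)%N -> (a n i <= M)%N).

(* Main.v *)
Require Import Defs.
From mathcomp Require Import all_boot all_order all_algebra.
From mathcomp Require Import all_classical all_reals all_analysis.
From mathcomp Require Import measurable_realfun zify ring lra.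

(** The orbit of a point of the base [B n] reads the infinite rank-one word,
    whose stage-[n] blocks have length [h n] and are separated by the spacers.

    If long windows of stages have all their spacers equal to [c], then
    [h N + c] is an almost period of every tower level, so [T] is rigid: some
    powers [T^r], [r > 0], converge to the identity. A limit of products of
    sparse such powers, chosen by diagonalization, commutes with [T] and is not
    a power of [T].

    Otherwise let [S] commute with [T]. The set [S^-1 (B m)] is almost a union
    of levels of the stage-[n] tower, so the visits of [S x] to [B m] are almost
    determined by the height of [x] in that tower. If an [n]-block of [x] and
    the half-overlapping [n]-block of [S x] were followed by different spacers,
    the [m]-blocks inside the [n]-block would be invariant under a nonzero shift
    smaller than [h m], which is impossible. Hence the spacer sequences of [x]
    and [S x] agree along a whole block of stage [n + l + k]. If the offset,
    counted in [n]-blocks, were not a multiple of the number of [n]-blocks in an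
    [(n + l)]-block, this agreement would make all spacers of the stages
    [n + l], ..., [n + l + k - 1] equal. So [S x] starts an [(n + l)]-block at
    distance at most [h n] from the start of one of [x], and [S] is a limit of
    powers of [T]. The same statement for [S = T^c] shows that the powers of
    [T] form a discrete set, so that [S] is itself a power of [T]. *)

Set Implicit Arguments.
Unset Strict Implicit.
Unset Printing Implicit Defensive.

Import Order.TTheory GRing.Theory Num.Theory.
Import numFieldNormedType.Exports.

Local Open Scope classical_set_scope.
Local Open Scope ring_scope.

(** * Positions of the blocks in the rank-one word *)

(** Boundedness enters through a single estimate. For fixed [m] and [K], the number [e] of errors
    allowed in one block is a fixed fraction of [h n], while [h (n + K)] is at most a constant times
    [h n]. Hence [e * mass (B (n + K))] stays above some [eps] that does not depend on [n]: an
    approximation within [eps] can be chosen first and the stage [n] afterwards, and one [eps]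
    serves all exponents [c] in the discreteness statement. The condition [A < h m] recurs because
    starts of [m]-blocks are at least [h m] apart, so two of them cannot differ by a discrepancy of
    spacers.

    In the rigid case the obstacle is to realize a limit in the measure algebra by a point map. The
    powers are made to converge fast on the countably many sets on which a coordinate [psi] of the
    space is at most a given rational. This determines the coordinate of the image point almost
    everywhere, completeness of the measure makes the resulting map measurable, and the opposite
    powers converge to its inverse. *)

Section word.
Variables (q : nat -> nat) (a : nat -> nat -> nat).

(* In the infinite rank-one word, [spacer n i] is the number of spacers between
   the [i]-th and the next stage-[n] block ([i > 0]; [i] itself is enough fuel
   since [1 < q n]) and [start n j] is the position of the block of index [j],
   counted from [0]. *)
Fixpoint spacer_fuel (f n i : nat) : nat :=
  if (q n %| i)%N then
    if f is f'.+1 then spacer_fuel f' n.+1 (i %/ q n) else 0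
  else a n (i %% q n).

Definition spacer (n i : nat) : nat := spacer_fuel i n i.

Definition start (n j : nat) : nat :=
  (j * height q a n + \sum_(1 <= i < j.+1) spacer n i)%N.

Definition starts (n : nat) : set nat := range (start n).

Definition cuts (n l : nat) : nat := (\prod_(n <= i < n + l) q i)%N.

Hypothesis q_gt1 : forall n, (1 < q n)%N.

Local Open Scope nat_scope.

Lemma q_gt0 n : 0 < q n.
Proof. exact: ltn_trans (q_gt1 n). Qed.

Lemma divq_gt0 n i : 0 < i -> q n %| i -> 0 < i %/ q n.
Proof. by move=> i0 /(dvdn_leq i0); rewrite divn_gt0 // q_gt0. Qed.

Lemma spacer_fuelE f g n i : 0 < i -> i <= f -> i <= g ->
  spacer_fuel f n i = spacer_fuel g n i.
Proof.
elim: f g n i => [|f IH] [|g] n i i0 lef leg; try by lia.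
rewrite /=; case: ifPn => // dv; have q1 := q_gt1 n.
have h1 : i %/ q n < i by rewrite ltn_Pdiv.
apply: IH; first by apply: divq_gt0.
  by rewrite -ltnS (leq_trans h1).
by rewrite -ltnS (leq_trans h1).
Qed.

Lemma spacerE n i : 0 < i ->
  spacer n i = if q n %| i then spacer n.+1 (i %/ q n) else a n (i %% q n).
Proof.
case: i => [//|i] _; rewrite {1}/spacer /=; case: ifPn => // dv.
have q1 := q_gt1 n.
apply: spacer_fuelE => //; first exact: divq_gt0.
by rewrite -ltnS ltn_Pdiv.
Qed.

Lemma start0 n : start n 0 = 0.
Proof. by rewrite /start mul0n big_geq. Qed.

Lemma startS n j : start n j.+1 = start n j + height q a n + spacer n j.+1.
Proof. by rewrite /start big_nat_recr //= mulSn; lia. Qed.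

Lemma leq_startS n j : start n j + height q a n <= start n j.+1.
Proof. by rewrite startS leq_addr. Qed.

Lemma height_gt0 n : 0 < height q a n.
Proof.
elim: n => [//|n IH] /=; rewrite ltn_addr // muln_gt0 IH andbT.
exact: q_gt0.
Qed.

Lemma ltn_start n j j' : j < j' -> start n j < start n j'.
Proof.
elim: j' => // j' IH; rewrite ltnS leq_eqVlt => /orP[/eqP->|/IH h].
  by rewrite (leq_trans _ (leq_startS n j')) // -[ltnLHS]addn0 ltn_add2l height_gt0.
by apply: ltn_trans h _; rewrite startS; have := height_gt0 n; lia.
Qed.

Lemma leq_start n j j' : j <= j' -> start n j <= start n j'.
Proof. by rewrite leq_eqVlt => /orP[/eqP->//|/(ltn_start n)/ltnW]. Qed.

Lemma start_lt_inv n j j' : start n j < start n j' -> j < j'.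
Proof. by rewrite !ltnNge => /negP h; apply/negP => /(leq_start n). Qed.

Lemma start_sep n j j' : j < j' -> start n j + height q a n <= start n j'.
Proof. by move=> /(leq_start n); apply: leq_trans (leq_startS _ _). Qed.

Lemma start_mul n j : start n (j * q n) = start n.+1 j.
Proof.
have q1 := q_gt1 n.
elim: j => [|j IH]; first by rewrite mul0n !start0.
(* Inside one stage-[n.+1] block no gap index is a multiple of [q n], so the gaps are the [a n i];
   only the gap that closes the block belongs to a later stage. *)
suff step k : k < q n -> start n (j * q n + k) =
    start n (j * q n) + k * height q a n + \sum_(1 <= i < k.+1) a n i.
  have -> : j.+1 * q n = (j * q n + (q n).-1).+1 by rewrite mulSnr; lia.
  rewrite startS step ?ltn_predL; last by lia.
  rewrite startS -IH -addnS prednK; last by lia.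
  rewrite -mulSnr spacerE ?muln_gt0 ?q_gt0 // dvdn_mull // mulnK ?q_gt0 //=.
  rewrite (_ : q n * _ = (q n).-1 * height q a n + height q a n).
    by lia.
  by rewrite -mulSnr prednK ?q_gt0.
elim: k => [|k IHk] kq; first by rewrite addn0 mul0n big_geq ?addn0.
rewrite addnS startS IHk; last by lia.
rewrite [in RHS]big_nat_recr //= -addnS spacerE ?addnS //.
by rewrite -addnS /dvdn modnMDl modn_small //= mulSn; lia.
Qed.

Lemma cuts0 n : cuts n 0 = 1.
Proof. by rewrite /cuts addn0 big_geq. Qed.

Lemma cutsSl n l : cuts n l.+1 = q n * cuts n.+1 l.
Proof. by rewrite /cuts addnS -addSn big_ltn //; lia. Qed.

Lemma cutsSr n l : cuts n l.+1 = cuts n l * q (n + l).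
Proof. by rewrite /cuts addnS big_nat_recr //= leq_addr. Qed.

Lemma cutsD n l l' : cuts n (l + l') = cuts n l * cuts (n + l) l'.
Proof. by elim: l' => [|l' IH];
  rewrite ?addn0 ?cuts0 ?muln1 // addnS !cutsSr IH mulnA addnA. Qed.

Lemma cuts_gt0 n l : 0 < cuts n l.
Proof.
elim: l => [|l IH]; first by rewrite cuts0.
by rewrite cutsSr muln_gt0 IH /=; apply: ltn_trans (q_gt1 _).
Qed.

Lemma start_muls n l j : start n (j * cuts n l) = start (n + l) j.
Proof.
elim: l j => [|l IH] j; first by rewrite cuts0 muln1 addn0.
by rewrite cutsSr addnS -start_mul -IH; congr start; lia.
Qed.

Lemma start_cuts n l j : start (n + l) j = start n (j * cuts n l).
Proof. by rewrite start_muls. Qed.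

Lemma leq_height_start n l : height q a (n + l) <= start n (cuts n l).
Proof.
by rewrite -[cuts n l]mul1n start_muls startS start0 add0n leq_addr.
Qed.

(** Gaps whose index is not a multiple of [cuts n l] lie strictly inside a stage-[n + l] block, and
    all these blocks have the same interior. *)
Lemma spacer_mod n l j : ~~ (cuts n l %| j) ->
  spacer n j = spacer n (j %% cuts n l).
Proof.
elim: l n j => [|l IH] n j; first by rewrite cuts0 dvd1n.
rewrite cutsSl => ndv.
have q1 := q_gt1 n; have c1 := cuts_gt0 n.+1 l.
have j0 : 0 < j by case: j ndv => //; rewrite dvdn0.
have r0 : 0 < j %% (q n * cuts n.+1 l) by rewrite lt0n.
rewrite (spacerE n j0) (spacerE n r0).
have -> : (q n %| j %% (q n * cuts n.+1 l)) = (q n %| j).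
  by rewrite /dvdn modn_dvdm // dvdn_mulr.
rewrite modn_dvdm ?dvdn_mulr //.
case: ifPn => // /dvdnP[j' ej].
have ndv' : ~~ (cuts n.+1 l %| j') by move: ndv;
  rewrite ej (mulnC j') dvdn_pmul2l ?q_gt0.
by rewrite ej mulnK ?q_gt0 // IH // (mulnC j') -muln_modr mulKn ?q_gt0.
Qed.

Lemma spacer_cuts n l i : 0 < i -> spacer n (cuts n l * i) = spacer (n + l) i.
Proof.
elim: l n i => [|l IH] n i i0; first by rewrite cuts0 mul1n addn0.
have q1 := q_gt1 n.
rewrite cutsSl -mulnA spacerE; last first.
  by rewrite !muln_gt0 i0 cuts_gt0 !andbT; lia.
by rewrite dvdn_mulr // mulKn ?IH ?addSnnS //; lia.
Qed.

Lemma startD n l j r : r < cuts n l ->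
  start n (j * cuts n l + r) = start n (j * cuts n l) + start n r.
Proof.
elim: r => [|r IH] rc; first by rewrite addn0 start0 addn0.
rewrite addnS !startS IH; last by lia.
rewrite -addnS (spacer_mod (l := l)).
  by rewrite modnMDl modn_small //; lia.
by rewrite dvdn_addr ?dvdn_mull // gtnNdvd.
Qed.

Lemma start_cuts_bound n l r : start n r < height q a (n + l) -> r < cuts n l.
Proof. by move=> /leq_trans/(_ (leq_height_start n l))/start_lt_inv. Qed.

(** No spacer follows the last stage-[n] block of a stage-[n + l] block: both end at the same
    position. *)
Lemma start_block n l r : r < cuts n l ->
  start n r + height q a n <= height q a (n + l).
Proof.
move=> rc.
have := start_sep n (leqnn (cuts n l).-1.+1).
have c0 := cuts_gt0 n l.
suff -> : height q a (n + l) = start n (cuts n l).-1 + height q a n.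
  by move=> _; rewrite leq_add2r leq_start //; lia.
have := startS n (cuts n l).-1.
rewrite prednK // -[X in start n X]mul1n start_muls startS start0 add0n.
by rewrite -[X in spacer n X]muln1 spacer_cuts //; lia.
Qed.

(** Self-similarity of the word: by [startD], every stage-[n] block contains its stage-[m] blocks at
    the same offsets as the first one. *)
Lemma starts_block m n j o : m <= n -> o < height q a n ->
  starts m (start n j + o) <-> starts m o.
Proof.
move=> /subnKC <-; set l := n - m => oh; rewrite start_cuts; split.
  move=> [r _ er].
  have r1 : j * cuts m l <= r.
    rewrite leqNgt; apply/negP => /(ltn_start m); lia.
  have r2 : r < j * cuts m l + cuts m l.
    rewrite -mulSnr; apply: (@start_lt_inv m).
    rewrite er !start_muls; apply: leq_trans (leq_startS _ _).
    by rewrite ltn_add2l.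
  exists (r - j * cuts m l) => //.
  have := startD j (_ : r - j * cuts m l < cuts m l).
  by rewrite subnKC // er => /(_ _)/addnI <- //; lia.
move=> [r _ er]; exists (j * cuts m l + r) => //.
by rewrite startD ?er // (start_cuts_bound (l := l)) ?er.
Qed.

Lemma starts_gap n u v : starts n u -> starts n v -> u < v ->
  u + height q a n <= v.
Proof. by move=> [j _ <-] [j' _ <-] /start_lt_inv; apply: start_sep. Qed.

Lemma height_mono n n' : n <= n' -> height q a n <= height q a n'.
Proof.
move=> /subnKC <-; have := start_block (cuts_gt0 n (n' - n)).
by rewrite start0.
Qed.

Lemma heightS_ge n : 2 * height q a n <= height q a n.+1.
Proof. by rewrite /= (leq_trans _ (leq_addr _ _)) // leq_mul2r q_gt1 orbT. Qed.

Lemma height_ge n l : 2 ^ l * height q a n <= height q a (n + l).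
Proof.
elim: l => [|l IH]; first by rewrite addn0 mul1n.
by rewrite addnS expnS -mulnA (leq_trans _ (heightS_ge _)) // leq_mul2l IH orbT.
Qed.

Lemma height_exp n : 2 ^ n <= height q a n.
Proof. by have := height_ge 0 n; rewrite muln1. Qed.

Lemma ltn_height n : n < height q a n.
Proof. exact: leq_trans (ltn_expl _ _) (height_exp n). Qed.

Variable A : nat.
Hypothesis a_le : forall n i, 0 < i < q n -> a n i <= A.

Lemma spacer_le n i : 0 < i -> spacer n i <= A.
Proof.
elim/ltn_ind: i n => i IH n i0; have q1 := q_gt1 n.
rewrite spacerE //; case: ifPn => dv.
  by apply: IH; [rewrite ltn_Pdiv|exact: divq_gt0].
by apply: a_le; rewrite lt0n dv ltn_mod q_gt0.
Qed.

Lemma startS_le n j : start n j.+1 <= start n j + height q a n + A.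
Proof. by rewrite startS leq_add2l spacer_le. Qed.

Lemma leq_start_id n j : j <= start n j.
Proof.
by elim: j => // j IH; rewrite startS; have := height_gt0 n; lia.
Qed.

Lemma start_around n u : exists j, start n j <= u < start n j.+1.
Proof.
have ex : exists j, u < start n j by exists u.+1; apply: leq_start_id.
case: (ex_minnP ex) => -[|j]; first by rewrite start0.
move=> lt min; exists j; rewrite lt andbT leqNgt; apply/negP => /min.
by rewrite ltnn.
Qed.

(** Consecutive starts are at most [height q a n + A] apart, so the nearer one is within half of
    that. The bounds are doubled to avoid halving natural numbers. *)
Lemma start_nearest n u : exists j,
  2 * start n j <= 2 * u + height q a n + A /\ 2 * u <= 2 * start n j + height
    q a n + A.
Proof.
have [j /andP[le lt]] := start_around n u.
have := startS_le n j; have := height_gt0 n.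
case: (leqP (2 * u) (2 * start n j + height q a n + A)) => h.
  by exists j; split => //; lia.
by exists j.+1; split; lia.
Qed.

Lemma starts_window n u : exists2 v, starts n v & u <= v < u + height q a n + A.
Proof.
case: u => [|u].
  exists 0; first by exists 0; rewrite ?start0.
  by have := height_gt0 n; lia.
have [j /andP[le lt]] := start_around n u.
exists (start n j.+1); first by exists j.+1.
by have := startS_le n j; lia.
Qed.


(* If the spacers following the matched blocks [r] and [j + r] differed, the
   shift would be a nonzero amount smaller than [height q a m], so each stage-[m]
   block in the overlap would produce a disagreement. *)
Lemma spacer_matched m n l j r u (f : nat -> bool) e :
  m <= n -> A < height q a m ->
  2 * e * (height q a m + A) + 3 * A <= height q a n ->
  (forall r r' o, r < cuts n l -> r' < cuts n l -> o < height q a n ->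
     f (start n r + o) = f (start n r' + o)) ->
  #|[pred t : 'I_(height q a (n + l)) | f t != `[< starts m (u + t) >]]| < e ->
  2 * start n j <= 2 * u + height q a n + A ->
  2 * u <= 2 * start n j + height q a n + A ->
  start n (j + r) = start n j + start n r ->
  r.+1 < cuts n l -> spacer n (j + r).+1 = spacer n r.+1.
Proof.
move=> mn Am hn fper; set bad := [pred t | _] => nbad n1 n2 jr rl.
apply/eqP/negPn/negP => /eqP neq; move: nbad; apply/negP; rewrite -leqNgt.
set h0 := height q a m in Am hn *; set h := height q a n in hn n1 n2 fper *.
set s0 := start n j in n1 n2 jr *; set W := spacer n r.+1 in neq *.
set W' := spacer n (j + r).+1 in neq *.
have WA : W <= A by apply: spacer_le.
have WA' : W' <= A by apply: spacer_le.
have rS : start n r.+1 = start n r + h + W by apply: startS.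
have jrS : start n (j + r).+1 = s0 + start n r + h + W' by rewrite startS jr.
have blk : start n r.+1 + h <= height q a (n + l) by apply: start_block.
(* Offsets from [A] on keep [o + W - W'] from being truncated; offsets from [u - s0] on lie in the
   overlap of the two matched blocks. The overlap has room for [e] windows of length [h0 + A] by the
   hypothesis [hn]. *)
pose lo := maxn A (u - s0).
have pick (w : 'I_e) : exists t : 'I_(height q a (n + l)), t \in bad /\
    exists2 o, lo + w * (h0 + A) <= o < lo + w.+1 * (h0 + A) &
      start n r <= s0 + start n r + o - u < start n r.+1 /\
      (t = s0 + start n r + o - u :> nat \/
      t = s0 + start n r + o - u + h + W :> nat).
  have [ o ho ob] := starts_window m (lo + w * (h0 + A)).
  have we : w.+1 * (h0 + A) <= e * (h0 + A) by rewrite leq_mul2r ltn_ord orbT.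
  rewrite mulSn in we; rewrite mulSn.
  have {}we : 2 * (w * (h0 + A)) + 2 * (h0 + A) + 3 * A <= h.
    by move: we hn; rewrite -mulnA; lia.
  move: (w * (h0 + A)) we ob => wh we ob.
  have oA : A <= o by rewrite /lo in ob; lia.
  have oh : o + A < h by rewrite /lo in ob; lia.
  have ou : u <= s0 + o < u + h by rewrite /lo in ob; lia.
  set t := s0 + start n r + o - u.
  have tb : start n r <= t < start n r + h by rewrite /t; lia.
  have tS : t + h + W = start n r.+1 + (t - start n r) by lia.
  have ft : f (t + h + W) = f t.
    rewrite tS (fper r.+1 r) //; first by congr f; lia.
    by rewrite (leq_trans _ rl).
    lia.
  have gt : starts m (u + t).
    have -> : u + t = start n (j + r) + o by rewrite jr /t; lia.
    by apply/(starts_block (j + r) mn) => //; lia.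
  (* A start here would give two starts inside one block at distance [|W - W'|], which is nonzero
     and at most [A], hence below [h0]. *)
  have gt' : ~ starts m (u + (t + h + W)).
    have -> : u + (t + h + W) = start n (j + r).+1 + (o + W - W').
      by rewrite jrS /t; lia.
    move=> /(starts_block (j + r).+1 mn); rewrite -/h => /(_ _) sW.
    have {}sW : starts m (o + W - W') by apply: sW; lia.
    case: (ltngtP o (o + W - W')) => c.
    - by have := starts_gap ho sW c; rewrite -/h0; lia.
    - by have := starts_gap sW ho c; rewrite -/h0; lia.
    - lia.
  have ltH : t < height q a (n + l) by lia.
  have ltH' : t + h + W < height q a (n + l) by lia.
  (* [f] has the same value at both positions while only the first one is a start, so [f] is wrong
     at one of them, chosen according to that value. *)
  case fE : (f t).
    exists (Ordinal ltH'); split; first by rewrite inE /= ft fE asboolF.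
    by exists o; [lia|split; [lia|right]].
  exists (Ordinal ltH); split; first by rewrite inE /= fE asboolT.
  by exists o; [lia|split; [lia|left]].
have [F FP] := fin_all_exists pick.
(* The position tells whether it lies before or after the start of block [r.+1], so it determines
   [o]; the windows are disjoint, so [o] determines [w]. *)
have Finj : injective F.
  move=> w w' eF; apply: val_inj => /=.
  have [_ [ o ob [tb to]]] := FP w; have [_ [ o' ob' [tb' to']]] := FP w'.
  rewrite eF in to.
  have eo : o = o' by lia.
  rewrite eo in ob.
  case: (ltngtP w w') => // c; have := leq_mul c (leqnn (h0 + A)); lia.
rewrite -[X in X <= _](card_ord e) -(card_imset _ Finj).
by apply: subset_leq_card; apply/fintype.subsetP => _ /imsetP[w _ ->]; have [] := FP w.
Qed.

(* When [j] is not a multiple of [cuts n l], the indices [j + t * cuts n l] are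
   all congruent to [j] and so carry one and the same spacer, which by the
   matching is also the spacer at every [t * cuts n l]. *)
Lemma matching m n l k u (f : nat -> bool) e :
  m <= n -> A < height q a m ->
  2 * e * (height q a m + A) + 3 * A <= height q a n ->
  (forall r r' o, r < cuts n (l + k) -> r' < cuts n (l + k) ->
     o < height q a n -> f (start n r + o) = f (start n r' + o)) ->
  #|[pred t : 'I_(height q a (n + (l + k))) | f t != `[< starts m (u + t) >]]|
    < e ->
  (exists s s' i i', [/\ n + l <= s < n + l + k, n + l <= s' < n + l + k,
     0 < i < q s, 0 < i' < q s' & a s i <> a s' i']) ->
  exists j, [/\ cuts n l %| j, 2 * start n j <= 2 * u + height q a n + A &
    2 * u <= 2 * start n j + height q a n + A].
Proof.
move=> mn Am hn fper nbad nconst; have [j [n1 n2]] := start_nearest n u.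
exists j; split => //; apply/negPn/negP => ndv.
(* The matched position must be carried along the induction, since [spacer_matched] compares the
   gaps after block [r] only once the starts up to [r] agree. *)
have same r : r < cuts n (l + k) -> start n (j + r) = start n j + start n r.
  elim: r => [|r IH] rl; first by rewrite addn0 start0 addn0.
  have e1 := IH (ltnW rl).
  rewrite addnS !startS e1.
  by rewrite (spacer_matched mn Am hn fper nbad n1 n2 e1 rl); lia.
have spE r : 0 < r -> r < cuts n (l + k) -> spacer n (j + r) = spacer n r.
  case: r => // r _ rl; have := same _ rl.
  by rewrite addnS !startS (same _ (ltnW rl)); lia.
have spj s i : n + l <= s < n + l + k -> 0 < i < q s ->
    a s i = spacer n (j %% cuts n l).
  move=> ss /andP[i0 iq]; pose p := s - (n + l).
  have es : s = (n + l) + p by rewrite /p; lia.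
  have pk : p < k by rewrite /p; lia.
  have ai : a s i = spacer n (cuts n (l + p) * i).
    rewrite spacer_cuts // addnA -es spacerE // gtnNdvd // modn_small //.
  rewrite ai -spE.
  - rewrite cutsD -mulnA (spacer_mod (l := l));
    first by rewrite addnC (mulnC (cuts n l)) modnMDl.
    by rewrite dvdn_addl // dvdn_mulr.
  - by rewrite muln_gt0 cuts_gt0.
  - have -> : l + k = (l + p).+1 + (k - p.+1) by lia.
    rewrite (cutsD n (l + p).+1) cutsSr (_ : n + (l + p) = s); last by lia.
    apply: (@leq_trans (cuts n (l + p) * q s)).
      by rewrite ltn_pmul2l ?cuts_gt0.
    by rewrite leq_pmulr ?cuts_gt0.
case: nconst => s [s' [i [i' [hs hs' hi hi' ne]]]]; apply: ne.
by rewrite !spj.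
Qed.

End word.

(** * Measure algebra *)

Section mass.
Context {d} {X : measurableType d} {R : realType} (mu : probability X R).
Implicit Types (A B C : set X) (S : X -> X).

Definition mass A : R := fine (mu A).

Definition dist A B : R := mass (A `+` B).

Definition preserving S :=
  measurable_fun setT S /\ forall A, measurable A -> mu (S @^-1` A) = mu A.

Lemma massE A : measurable A -> mu A = (mass A)%:E.
Proof.
move=> mA; rewrite /mass fineK // ge0_fin_numE ?measure_ge0 //.
by rewrite (le_lt_trans (probability_le1 mu mA)) // ltry.
Qed.

Lemma mass_ge0 A : 0 <= mass A.
Proof. by rewrite /mass fine_ge0 // measure_ge0. Qed.

Lemma mass_setT : mass setT = 1.
Proof. by rewrite /mass probability_setT. Qed.

Lemma mass_set0 : mass set0 = 0.
Proof. by rewrite /mass measure0. Qed.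

Lemma le_mass A B : measurable A -> measurable B -> A `<=` B -> mass A <= mass B.
Proof.
move=> mA mB AB; rewrite -lee_fin -!massE //.
by apply: le_measure => //; rewrite inE.
Qed.

Lemma mass_le1 A : measurable A -> mass A <= 1.
Proof. by move=> mA; rewrite -mass_setT; exact: le_mass. Qed.

Lemma mass_setU_le A B : measurable A -> measurable B ->
  mass (A `|` B) <= mass A + mass B.
Proof.
move=> mA mB; rewrite -lee_fin EFinD -!massE //; last exact: measurableU.
exact: measureU2.
Qed.

Lemma mass_setU A B : measurable A -> measurable B -> A `&` B = set0 ->
  mass (A `|` B) = mass A + mass B.
Proof.
move=> mA mB AB; apply: EFin_inj; rewrite EFinD -!massE //; last exact: measurableU.
by rewrite measureU.
Qed.

Lemma mass_setC A : measurable A -> mass (~` A) = 1 - mass A.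
Proof.
move=> mA; rewrite -mass_setT -(setUv A) mass_setU ?setICr //.
  by rewrite addrAC subrr add0r.
exact: measurableC.
Qed.

Lemma mass_bigsetU_le n (F : nat -> set X) : (forall i, measurable (F i)) ->
  mass (\big[setU/set0]_(i < n) F i) <= \sum_(i < n) mass (F i).
Proof.
move=> mF; elim: n => [|n IH]; first by rewrite !big_ord0 mass_set0.
rewrite !big_ord_recr /=; apply: le_trans (mass_setU_le _ _) _ => //.
  by apply: bigsetU_measurable.
by rewrite lerD2r.
Qed.

Lemma mass_bigcup_lub (F : nat -> set X) c : (forall i, measurable (F i)) ->
  (forall n, mass (\big[setU/set0]_(i < n) F i) <= c) -> mass (\bigcup_i F i) <= c.
Proof.
move=> mF Fc; have mU : measurable (\bigcup_i F i) by exact: bigcupT_measurable.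
rewrite -lee_fin -massE //.
have -> : \bigcup_i F i = \bigcup_n \big[setU/set0]_(i < n) F i.
  apply/seteqP; split => x.
    move=> [i _ Fx]; exists i.+1 => //; rewrite big_ord_recr /=; by right.
  move=> [n _]; rewrite -bigcup_mkord => -[i _ Fx]; by exists i.
have nd : nondecreasing_seq (fun n => \big[setU/set0]_(i < n) F i).
  move=> m n mn; apply/subsetPset; rewrite -!bigcup_mkord => x [i /= im Fx].
  by exists i => //=; exact: leq_trans mn.
have mB n : measurable (\big[setU/set0]_(i < n) F i) by exact: bigsetU_measurable.
have /= := nondecreasing_cvg_mu (mu := mu) mB (bigcupT_measurable _ mB) nd.
move/cvg_lim => <- //; apply: lime_le.
  by apply/cvg_ex; eexists; exact:
    (nondecreasing_cvg_mu (mu := mu) mB (bigcupT_measurable _ mB) nd).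
apply: nearW => n /=; rewrite [X in (X <= _)%E](massE (mB n)) lee_fin.
exact: Fc.
Qed.

Lemma mass_bigcup_le (F : nat -> set X) c : (forall i, measurable (F i)) ->
  (forall n, \sum_(i < n) mass (F i) <= c) -> mass (\bigcup_i F i) <= c.
Proof.
move=> mF Fc; apply: mass_bigcup_lub => // n.
exact: le_trans (mass_bigsetU_le _ mF) (Fc n).
Qed.

Lemma mass_bigcup_approx (F : nat -> set X) e : (forall i, measurable (F i)) ->
  0 < e -> exists n, mass (\bigcup_i F i) - e < mass (\big[setU/set0]_(i < n) F i).
Proof.
move=> mF e0; apply: contrapT => nex.
suff : mass (\bigcup_i F i) <= mass (\bigcup_i F i) - e by lra.
apply: mass_bigcup_lub => // n; rewrite leNgt; apply/negP => lt.
by apply: nex; exists n.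
Qed.

Lemma measurable_setY A B : measurable A -> measurable B -> measurable (A `+` B).
Proof. by move=> mA mB; apply: measurableU; apply: measurableD. Qed.

Lemma dist_ge0 A B : 0 <= dist A B.
Proof. exact: mass_ge0. Qed.

Lemma distC A B : dist A B = dist B A.
Proof. by rewrite /dist setYC. Qed.

Lemma distAA A : dist A A = 0.
Proof. by rewrite /dist setYK mass_set0. Qed.

Lemma dist_triangle B A C : measurable A -> measurable B -> measurable C ->
  dist A C <= dist A B + dist B C.
Proof.
move=> mA mB mC.
have mAB := measurable_setY mA mB; have mBC := measurable_setY mB mC.
apply: le_trans (mass_setU_le mAB mBC).
apply: le_mass; [exact: measurable_setY|exact: measurableU|].
by move=> x /=; have [] := pselect (B x); tauto.
Qed.

Lemma mass_dist A B : measurable A -> measurable B ->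
  mass A <= mass B + dist A B.
Proof.
move=> mA mB; have mAB := measurable_setY mA mB.
apply: le_trans (mass_setU_le mB mAB).
apply: le_mass => //; first exact: measurableU.
by move=> x Ax /=; have [] := pselect (B x); tauto.
Qed.

Lemma dist_disjoint A B : measurable A -> measurable B -> A `&` B = set0 ->
  dist A B = mass A + mass B.
Proof.
move=> mA mB AB; rewrite -mass_setU // /dist; congr mass.
apply/seteqP; split => x /=; first by tauto.
have : ~ (A `&` B) x by rewrite AB.
by move=> /= h; tauto.
Qed.

Lemma measurable_pre S A : preserving S -> measurable A -> measurable (S @^-1` A).
Proof. by move=> [mS _] mA; rewrite -[X in measurable X]setTI; exact: mS. Qed.

Lemma mass_pre S A : preserving S -> measurable A -> mass (S @^-1` A) = mass A.
Proof. by move=> [_ pS] mA; rewrite /mass pS. Qed.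

Lemma dist_pre S A B : preserving S -> measurable A -> measurable B ->
  dist (S @^-1` A) (S @^-1` B) = dist A B.
Proof. move=> pS mA mB; exact: (mass_pre pS (measurable_setY mA mB)). Qed.

Lemma preserving_comp S S' : preserving S -> preserving S' ->
  preserving (S' \o S).
Proof.
move=> [mS pS] [mS' pS']; split; first exact: measurableT_comp.
move=> A mA; rewrite comp_preimage pS ?pS' //.
by rewrite -[X in measurable X]setTI; exact: mS'.
Qed.

Lemma negligible_pre S N : preserving S -> mu.-negligible N ->
  mu.-negligible (S @^-1` N).
Proof.
move=> pS [N' [mN' N0 NN']]; exists (S @^-1` N'); split.
- exact: measurable_pre.
- by case: pS => _ ->.
- by move=> x; apply: NN'.
Qed.

Lemma mass_negligible A : measurable A -> mu.-negligible A -> mass A = 0.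
Proof. by move=> mA /(negligibleP _ mA) A0; rewrite /mass A0. Qed.

Lemma negligible_mass A : measurable A -> mass A <= 0 -> mu.-negligible A.
Proof.
move=> mA A0; apply/negligibleP => //; apply: etrans (massE mA) _; congr EFin.
by apply/eqP; rewrite eq_le A0 mass_ge0.
Qed.

(** Markov's inequality: the function counting the sets [G t] that contain a point is integrated
    over [B] minus a null set. *)
Lemma sum_mass_ge H (G : 'I_H -> set X) B (N : set X) e :
  (forall t, measurable (G t)) -> measurable B -> mu.-negligible N ->
  (forall x, B x -> ~ N x -> (e <= #|[pred t : 'I_H | `[< G t x >]]|)%N) ->
  e%:R * mass B <= \sum_(t < H) mass (B `&` G t).
Proof.
move=> mG mB [N' [mN' N0 NN']] cnt.
pose D := B `\` N'; have mD : measurable D by exact: measurableD.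
have mN'0 : mass N' = 0 by rewrite /mass N0.
have -> : mass B = mass D.
  apply/eqP; rewrite eq_le; apply/andP; split; last first.
    by apply: le_mass => // x [].
  rewrite -[leRHS]addr0 -mN'0; apply: le_trans (mass_setU_le mD mN').
  apply: le_mass => //; first exact: measurableU.
  by move=> x Bx; have [] := pselect (N' x); [right|left].
apply: (@le_trans _ _ (\sum_(t < H) mass (D `&` G t))); last first.
  apply: ler_sum => t _; apply: le_mass; [exact: measurableI|exact: measurableI|].
  by move=> x [[Bx _] Gx].
rewrite -lee_fin EFinM -massE // -integral_cst //.
have -> : (\sum_(t < H) mass (D `&` G t))%:E =
    (\int[mu]_(x in D) (\sum_(t < H) (\1_(G t) x)%:E))%E.
  rewrite ge0_integral_sum //=.
  - rewrite -sumEFin; apply: eq_bigr => t _.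
    rewrite integral_indic // setIC; apply/esym/massE; exact: measurableI.
  - move=> t; apply/measurable_EFinP; exact: measurable_indic.
apply: ge0_le_integral => //=.
- apply: emeasurable_sum => t; apply/measurable_EFinP; exact: measurable_indic.
- move=> x [Bx nx]; rewrite sumEFin lee_fin.
  have /(cnt x Bx) : ~ N x by move=> /NN'.
  rewrite -(ler_nat R) => /le_trans; apply.
  rewrite -sum1_card natr_sum big_mkcond /=; apply: ler_sum => t _.
  rewrite indicE; case: ifPn => /=.
    by move=> /asboolP Gx; rewrite mem_set.
  by move=> _; rewrite ler0n.
Qed.

End mass.

(** * Orbits and towers *)

Section powers.
Context {d} {X : measurableType d} {R : realType} (mu : probability X R).
Variable T : mp_aut mu.

Local Notation tp := (aut_pow T).

Lemma aut_powS z x : tp (z + 1) x = T (tp z x).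
Proof.
case: z => [k|[|k]].
- by have -> : Posz k + 1 = Posz k.+1 by lia.
- by rewrite [Negz 0 + 1](_ : _ = Posz 0) //= aut_invK.
- have -> : Negz k.+1 + 1 = Negz k by rewrite !NegzE; lia.
  by rewrite /= aut_invK.
Qed.

Lemma aut_powB z x : tp (z - 1) x = aut_inv T (tp z x).
Proof. by rewrite -{2}[z](subrK 1) aut_powS aut_funK. Qed.

Lemma aut_powD z w x : tp (z + w) x = tp z (tp w x).
Proof.
elim/int_rect: z => [|k IH|k IH]; first by rewrite add0r.
- have -> : k.+1%:Z = k%:Z + 1 by lia.
  by rewrite addrAC !aut_powS IH.
- rewrite (_ : - k.+1%:Z = - k%:Z - 1); last by lia.
  by rewrite addrAC !aut_powB IH.
Qed.

Lemma aut_powK z : cancel (tp z) (tp (- z)).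
Proof. by move=> x; rewrite -aut_powD addNr. Qed.

Lemma aut_powNK z : cancel (tp (- z)) (tp z).
Proof. by move=> x; rewrite -aut_powD addrN. Qed.

Lemma preserving_fun : preserving mu T.
Proof. by split; [exact: measurable_aut_fun|exact: aut_preserving]. Qed.

Lemma preserving_inv : preserving mu (aut_inv T).
Proof.
split=> [|A mA]; first exact: measurable_aut_inv.
have mI : measurable (aut_inv T @^-1` A).
  by rewrite -[X in measurable X]setTI; exact: measurable_aut_inv.
rewrite -(aut_preserving T mI); congr (mu _).
by apply/seteqP; split => x /=; rewrite aut_funK.
Qed.

Lemma preserving_id : preserving mu id.
Proof. by split => //; exact: measurable_id. Qed.

Lemma preserving_iter k (f : X -> X) : preserving mu f -> preserving mu (iter k f).
Proof.
move=> pf; elim: k => [|k IH]; first exact: preserving_id.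
exact: preserving_comp IH pf.
Qed.

Lemma preserving_pow z : preserving mu (tp z).
Proof.
case: z => k; first exact: preserving_iter preserving_fun.
exact: preserving_iter preserving_inv.
Qed.

(** Stated for plain maps because a limit of powers is shown to commute with [T] before it is
    corrected to an element of [mp_aut]. *)
Definition commuting (S : X -> X) := mu.-negligible [set x | S (T x) <> T (S x)].

Lemma commuting_nat S : commuting S ->
  mu.-negligible [set x | exists t : nat, S (tp t x) <> tp t (S x)].
Proof.
move=> cS; apply: (@negligibleS _ _ _ _ (\bigcup_(t :
  nat) (tp t @^-1` [set x | S (T x) <> T (S x)]))).
  move=> x [t]; elim: t => [//|t IH] ne.
  have [e|/IH//] := pselect (S (tp t x) = tp t (S x)).
  by exists t => //= e'; apply: ne; rewrite e' e.
by apply: negligible_bigcup => t; apply: negligible_pre cS; exact: preserving_pow.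
Qed.

Lemma commuting_pow z : commuting (tp z).
Proof.
apply: negligibleS (negligible_set0 _) => x /=; apply.
by rewrite -[T x](aut_powS 0 x) -aut_powS -aut_powD; congr aut_pow; lia.
Qed.

End powers.

Arguments aut_pow : simpl never.

(** * Stage towers and the visits of orbits to their bases *)

Section towers.
Context {d} {X : measurableType d} {R : realType} (mu : probability X R).
Variables (T : mp_aut mu) (q : nat -> nat) (a : nat -> nat -> nat).

Local Notation tp := (aut_pow T).
Local Notation mass := (mass mu).
Local Notation dist := (dist mu).
Local Notation h := (height q a).

(** The pieces and spacer sets of [towers] are eliminated: by [base_cut], [B n] is the union of the
    translates of [B n.+1] by starts of the word. Only [B] and powers of [T] remain, a form that
    pulls back along an isomorphism. *)
Record tower_bases (B : nat -> set X) : Prop := TowerBases {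
  base_measurable : forall n, measurable (B n) ;
  base_cut : forall n x, B n x <->
    exists2 r, (r < q n)%N & B n.+1 (tp (- (start q a n r)%:Z) x) ;
  base_disjoint : forall n (k : nat) x, (0 < k < h n)%N -> B n x -> ~ B n (tp k x) ;
  base_dense : forall A (e : R), measurable A -> 0 < e ->
    exists2 s : seq (nat * nat), (forall p, p \in s -> (p.2 < h p.1)%N) &
      dist A (\big[setU/set0]_(p <- s) (tp (- (p.2)%:Z) @^-1` B p.1)) < e
}.

Variable B : nat -> set X.
Hypothesis HB : tower_bases B.
Hypothesis q_gt1 : forall n, (1 < q n)%N.

(* The level [T^k (B n)]; throughout, images under [T^k] are written as
   preimages under [T^-k]. *)
Definition lev n k := tp (- k%:Z) @^-1` B n.

Lemma measurable_lev n k : measurable (lev n k).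
Proof. by apply: measurable_pre (base_measurable HB n); exact: preserving_pow. Qed.

Lemma mass_lev n k : mass (lev n k) = mass (B n).
Proof. by apply: mass_pre (base_measurable HB n); exact: preserving_pow. Qed.

Lemma base_cuts n l x : B n x <->
  exists2 r, (r < cuts q n l)%N & B (n + l)%N (tp (- (start q a n r)%:Z) x).
Proof.
elim: l x => [|l IH] x.
  rewrite addn0 cuts0; split => [Bx|[[|//] _]]; rewrite ?start0 ?oppr0 //.
  by exists 0%N; rewrite ?start0 ?oppr0.
have q1 := q_gt1 (n + l); have c0 := cuts_gt0 q_gt1 n l.
rewrite IH addnS cutsSr; split => [[r rc /(base_cut HB)[r' r'q Br]]|[r rc Br]].
  exists (r' * cuts q n l + r)%N; first by nia.
  by rewrite startD // start_muls // PoszD opprD aut_powD.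
exists (r %% cuts q n l)%N; first by rewrite ltn_mod.
apply/(base_cut HB); exists (r %/ cuts q n l)%N; first by rewrite ltn_divLR // mulnC.
rewrite -start_muls // -aut_powD -opprD -PoszD -startD ?ltn_mod //.
by rewrite -divn_eq.
Qed.

Lemma base_sub n n' : (n <= n')%N -> B n' `<=` B n.
Proof.
move=> /subnKC <- x Bx; apply/(base_cuts n (n' - n)); exists 0%N.
  exact: cuts_gt0.
by rewrite start0.
Qed.

Lemma base_disjointZ n (z : int) x : (`|z| < h n)%N -> B n x -> B n (tp z x) -> z = 0.
Proof.
case: z => k /=; rewrite ?abszE => kh Bx Bz.
  by case: k kh Bz => // k kh Bz; case: (base_disjoint HB _ Bx Bz).
have := @base_disjoint _ HB n k.+1 (tp (Negz k) x).
by rewrite kh -aut_powD NegzE subrr => /(_ isT Bz)/(_ Bx).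
Qed.

(** The bridge from orbits to the word. A visit at time [t] comes from some start [r]; if [t]
    differed from it, [B n'] would meet a translate of itself by less than [h n']. *)
Lemma base_visit n n' x t : (n <= n')%N -> B n' x -> (t < h n')%N ->
  B n (tp t x) <-> starts q a n t.
Proof.
move=> nn' Bx th; move: (nn') => /subnKC enn'; split.
  move=> /(base_cuts n (n' - n)) [r rc]; rewrite enn' -aut_powD => Br.
  exists r => //; suff : t%:Z - (start q a n r)%:Z = 0 by lia.
  apply: (base_disjointZ _ Bx) => //; last by rewrite addrC.
  by have := start_block a q_gt1 rc; rewrite enn'; have := height_gt0 a q_gt1 n; lia.
move=> [r _ er]; apply/(base_cuts n (n' - n)); exists r.
  by apply: (start_cuts_bound q_gt1 (a := a)); rewrite er enn'.
by rewrite enn' er aut_powK.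
Qed.

Lemma lev_visit n n' x j t : (n <= n')%N -> B n' x -> (t < h n')%N ->
  (j < h n)%N -> lev n j (tp t x) <-> (j <= t)%N /\ starts q a n (t - j)%N.
Proof.
move=> nn' Bx th jh; rewrite /lev /= -aut_powD.
have [jt|tj] := leqP j t.
  rewrite (_ : - j%:Z + t%:Z = (t - j)%N%:Z); last by lia.
  rewrite (base_visit nn' Bx); last by lia.
  by split=> [|[]].
split => [Bz|[//]]; have Bn := base_sub nn' Bx.
by have := base_disjointZ _ Bn Bz; lia.
Qed.

Definition tower n := \big[setU/set0]_(k < h n) lev n k.

Lemma towerP n x : tower n x <-> exists2 k, (k < h n)%N & B n (tp (- k%:Z) x).
Proof.
rewrite /tower -bigcup_mkord; split => -[k kh Bk]; by exists k.
Qed.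

Lemma measurable_tower n : measurable (tower n).
Proof. by apply: bigsetU_measurable => k _; exact: measurable_lev. Qed.

Lemma lev_disjoint n j k : (j < k < h n)%N -> lev n j `&` lev n k = set0.
Proof.
move=> jk; apply/seteqP; split => // x [Bj Bk].
have := @base_disjointZ n (j%:Z - k%:Z) _ _ Bj.
by rewrite -aut_powD addrAC subrr add0r => /(_ _ Bk); lia.
Qed.

Lemma mass_bigsetU_lev n H (E : set X) : (H <= h n)%N -> measurable E ->
  mass (\big[setU/set0]_(k < H) (lev n k `&` E)) = \sum_(k < H) mass (lev n k `&` E).
Proof.
move=> Hh mE; have mI k : measurable (lev n k `&` E).
  by apply: measurableI => //; exact: measurable_lev.
elim: H Hh => [|H IH] Hh; first by rewrite !big_ord0 mass_set0.
rewrite !big_ord_recr /= mass_setU ?IH //; first by lia.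
- exact: bigsetU_measurable.
- rewrite -(bigcup_mkord _ (fun k => lev n k `&` E)); apply/seteqP;
  split => // x [[k /= kH [lk _]] [lH _]].
  have : (lev n k `&` lev n H) x by [].
  by rewrite lev_disjoint //; lia.
Qed.

Lemma sum_mass_lev n (E : set X) : measurable E ->
  \sum_(k < h n) mass (lev n k `&` E) <= mass E.
Proof.
move=> mE; rewrite -mass_bigsetU_lev //; apply: le_mass => //.
  apply: bigsetU_measurable => k _; apply: measurableI => //.
  exact: measurable_lev.
by rewrite -(bigcup_mkord _ (fun k => lev n k `&` E)) => x [k _ []].
Qed.

Lemma mass_tower_sub n H : (H <= h n)%N ->
  mass (\big[setU/set0]_(k < H) lev n k) = H%:R * mass (B n).
Proof.
move=> Hh; have := @mass_bigsetU_lev n H setT Hh measurableT.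
under eq_bigr do rewrite setIT; move=> ->.
under eq_bigr do rewrite setIT mass_lev.
by rewrite sumr_const card_ord mulr_natl.
Qed.

Lemma mass_tower n : mass (tower n) = (h n)%:R * mass (B n).
Proof. exact: mass_tower_sub. Qed.

Lemma mass_base_le n : mass (B n) <= (h n)%:R^-1.
Proof.
have h0 : 0 < (h n)%:R :> R by rewrite ltr0n height_gt0.
rewrite -(ler_pM2l h0) mulfV ?gt_eqF // -mass_tower.
exact/mass_le1/measurable_tower.
Qed.

Lemma tower_sub n n' : (n <= n')%N -> tower n `<=` tower n'.
Proof.
move=> nn' x /towerP[k kh Bk]; apply/towerP; have enn' := subnKC nn'.
move: Bk => /(base_cuts n (n' - n))[r rc Br].
exists (start q a n r + k)%N.
  by have := start_block a q_gt1 rc; rewrite enn'; lia.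
by rewrite PoszD opprD aut_powD -enn'.
Qed.

Lemma lev_tower n k : (k < h n)%N -> lev n k `<=` tower n.
Proof. by move=> kh x Bx; apply/towerP; exists k. Qed.

(** Density applied to the whole space gives finitely many levels that nearly fill it, and every
    later tower contains them. *)
Lemma tower_full (e : R) : 0 < e -> exists N, forall n,
  (N <= n)%N -> 1 - mass (tower n) < e.
Proof.
move=> e0; have [s sh sd] := base_dense HB measurableT e0.
exists (\max_(p <- s) p.1) => n Nn; apply: le_lt_trans sd.
rewrite /dist setYC setYTC -mass_setC; last exact: measurable_tower.
apply: le_mass.
- exact/measurableC/measurable_tower.
- apply: measurableC; apply: bigsetU_measurable => p _; exact: measurable_lev.
- apply: subsetC; rewrite -bigcup_seq => x [p /= ps Bx].
  apply: (@tower_sub p.1); last exact: lev_tower (sh _ ps) _ Bx.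
  by apply: leq_trans Nn; exact: leq_bigmax_seq.
Qed.

Lemma mass_base_gt0 n : 0 < mass (B n).
Proof.
have [|N /(_ (maxn N n))] := @tower_full (2^-1); first by lra.
rewrite leq_maxl mass_tower => /(_ isT) lt.
have : 0 < mass (B (maxn N n)).
  rewrite lt_neqAle mass_ge0 andbT; apply/eqP => e0.
  by move: lt; rewrite -e0 mulr0; lra.
move=> /lt_le_trans; apply; apply: le_mass; try exact: base_measurable.
by apply: base_sub; exact: leq_maxr.
Qed.

(** The top [H.+1] levels of the stage-[m] tower have mass at most [H.+1 / h m], which tends to 0,
    while the towers fill the space. So almost every orbit reads the word for [H] more steps within
    one late tower. *)
Lemma negligible_deep (H M0 : nat) : mu.-negligible [set x |
  ~ exists m i, [/\ (M0 <= m)%N, (i + H < h m)%N & B m (tp (- i%:Z) x)]].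
Proof.
set N := [set x | _].
pose D m := \big[setU/set0]_(k < h m - H.+1) lev m k.
pose F := ~` \bigcup_(m in [set m | (M0 <= m)%N]) D m.
have mD m : measurable (D m) by apply: bigsetU_measurable => k _; exact: measurable_lev.
have mF : measurable F by apply/measurableC/bigcup_measurable => m _; exact: mD.
suff : mu.-negligible F.
  apply: negligibleS => x nx [m /= Mm]; rewrite /D -bigcup_mkord => -[i /= ih Bi].
  by apply: nx; exists m, i; split => //; lia.
apply: negligible_mass => //; apply/ler_addgt0Pr => e e0; rewrite add0r.
have [|N1 HN1] := @tower_full (e / 2); first by lra.
have [N2 HN2] : exists N2, H.+1%:R / (h N2)%:R < e / 2 :> R.
  have [N2 HN2] : exists N2 : nat, H.+1%:R / (e / 2) < N2%:R :> R.
    by exists (Num.bound (H.+1%:R / (e / 2)));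
      rewrite archi_boundP // divr_ge0 // ?ler0n; lra.
  exists N2; have h0 : 0 < (h N2)%:R :> R by rewrite ltr0n height_gt0.
  rewrite ltr_pdivrMr // mulrC -ltr_pdivrMr; last by lra.
  apply: lt_le_trans HN2 _; rewrite ler_nat.
  have := height_ge a q_gt1 0 N2; rewrite add0n /= muln1; apply: leq_trans.
  exact/ltnW/ltn_expl.
pose m := maxn M0 (maxn N1 N2).
have {}HN1 : 1 - mass (tower m) < e / 2 by apply: HN1; rewrite /m; lia.
have h0 n : 0 < (h n)%:R :> R by rewrite ltr0n height_gt0.
have {}HN2 : H.+1%:R * mass (B m) < e / 2.
  apply: le_lt_trans HN2; rewrite ler_wpM2l ?ler0n //.
  apply: le_trans (mass_base_le m) _; rewrite lef_pV2 ?posrE // ler_nat.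
  by apply: height_mono => //; rewrite /m; lia.
have FD : F `<=` ~` D m by apply: subsetC => x Dx; exists m => //=; rewrite /m; lia.
apply: le_trans (le_mass mu mF (measurableC (mD m)) FD) _.
rewrite mass_setC // /D mass_tower_sub; last by lia.
have := mass_base_gt0 m.
rewrite mass_tower in HN1.
have : (h m)%:R <= (h m - H.+1)%:R + H.+1%:R :> R by rewrite -natrD ler_nat; lia.
by move=> le /ltW B0; have := ler_wpM2r B0 le; lra.
Qed.

(** Within the stage-[n] tower [U] is a union of levels; nothing is required outside that tower. *)
Definition saturated n (U : set X) := forall z z' (o : nat), B n z -> B n z' ->
  (o < h n)%N -> U (tp o z) -> U (tp o z').

Lemma saturated_lev n n' j : (n <= n')%N -> (j < h n)%N -> saturated n' (lev n j).
Proof. by move=> nn' jh z z' o Bz Bz' oh; rewrite !(lev_visit nn'). Qed.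

Lemma saturated_base n n' : (n <= n')%N -> saturated n' (B n).
Proof. by move=> nn' z z' o Bz Bz' oh; rewrite !(base_visit nn'). Qed.

Lemma saturated_levels n (s : seq (nat * nat)) :
  (forall p, p \in s -> (p.2 < h p.1)%N /\ (p.1 <= n)%N) ->
  saturated n (\big[setU/set0]_(p <- s) lev p.1 p.2).
Proof.
move=> sh z z' o Bz Bz' oh; rewrite -bigcup_seq => -[p /= ps Lp].
by exists p => //=; have [ph pn] := sh _ ps; exact: (saturated_lev pn ph Bz Bz' oh Lp).
Qed.

End towers.

(** * Rigidity of offsets between commuting maps *)

Section centralizer.
Context {d} {X : measurableType d} {R : realType} (mu : probability X R).
Variables (T : mp_aut mu) (q : nat -> nat) (a : nat -> nat -> nat).

Local Notation tp := (aut_pow T).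
Local Notation mass := (mass mu).
Local Notation dist := (dist mu).
Local Notation h := (height q a).

Variable B : nat -> set X.
Hypothesis HB : tower_bases T q a B.
Hypothesis q_gt1 : forall n, (1 < q n)%N.
Variables M A : nat.
Hypothesis q_le : forall n, (q n <= M)%N.
Hypothesis a_le : forall n i, (0 < i < q n)%N -> (a n i <= A)%N.

Local Notation lev := (lev T B).
Local Notation tower := (tower T q a B).
Local Notation saturated := (saturated T q a B).

Definition varying_spacers n k := exists s s' i i' : nat,
  [/\ (n <= s < n + k)%N, (n <= s' < n + k)%N,
      (0 < i < q s)%N, (0 < i' < q s')%N & a s i <> a s' i'].

(* The levels of the stage-[n + (l + k)] tower are disjoint, so the average
   number of visits to the error set [S^-1 (B m) + U] during one pass through
   that tower is below [e]; some pass thus has fewer than [e] errors. *)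
Lemma window_shift (S : X -> X) m n l k e U :
  preserving mu S -> commuting T S -> (m <= n)%N -> (A < h m)%N ->
  (2 * e * (h m + A) + 3 * A <= h n)%N -> varying_spacers (n + l) k ->
  measurable U -> saturated n U ->
  dist (S @^-1` B m) U < e%:R * mass (B (n + (l + k))%N) ->
  exists x (s : int), [/\ B (n + (l + k))%N x, (2 * `|s| <= h n + A)%N,
    B (n + l)%N (tp s (S x)), forall t : nat, S (tp t x) = tp t (S x) &
    (#|[pred t : 'I_(h (n + (l + k))) |
       `[< ((S @^-1` B m) `+` U) (tp t x) >]]| < e)%N].
Proof.
move=> pS cS mn Am hn vary mU sU; set N := (n + (l + k))%N; set H := h N.
set E := _ `+` U => dE.
have mSB : measurable (S @^-1` B m).
  exact: (measurable_pre pS (base_measurable HB m)).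
have mE : measurable E by exact: measurable_setY.
(* Outside these null sets [S] commutes with all forward powers at [x], and the next [H] steps of
   [S x] stay inside one tower, so both orbits can be read in the word. *)
pose N1 := [set x | exists t : nat, S (tp t x) <> tp t (S x)].
pose N2 := [set x | ~ exists m i,
  [/\ (N <= m)%N, (i + H < h m)%N & B m (tp (- i%:Z) x)]].
have nN : mu.-negligible (N1 `|` S @^-1` N2).
  apply: negligibleU; first exact: commuting_nat.
  apply: negligible_pre => //; exact: negligible_deep.
have [x [Bx nx cx]] : exists x, [/\ B N x, ~ (N1 `|` S @^-1` N2) x &
    (#|[pred t : 'I_H | `[< E (tp t x) >]]| < e)%N].
  apply: contrapT => nex; move: dE; apply/negP; rewrite -leNgt.
  apply: le_trans (sum_mass_ge (G := fun t : 'I_H => tp t @^-1` E) _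
    (base_measurable HB N) nN _) _.
  - by move=> t; apply: measurable_pre mE; exact: preserving_pow.
  - move=> x Bx nx; rewrite leqNgt; apply/negP => lt; apply: nex.
    by exists x.
  - apply: le_trans (sum_mass_lev HB N mE); apply: ler_sum => t _.
    have mBt : measurable (B N `&` tp t @^-1` E).
      apply: measurableI (base_measurable HB N) _.
      by apply: measurable_pre mE; exact: preserving_pow.
    (* Moving by [T^t] turns the errors made at time [t] into the part of [E] on level [t]; distinct
       levels are disjoint. *)
    rewrite -(mass_pre (preserving_pow T (- t%:Z)) mBt).
    apply: le_mass.
    + by apply: measurable_pre mBt; exact: preserving_pow.
    + by apply: measurableI mE; exact: (measurable_lev HB).
    + by move=> y [By /=]; rewrite aut_powNK.
have {nx}[n1 n2] : (forall t : nat, S (tp t x) = tp t (S x)) /\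
    exists M i, [/\ (N <= M)%N, (i + H < h M)%N & B M (tp (- i%:Z) (S x))].
  split; last by apply: contrapT => nx2; apply: nx; right.
  by move=> t; apply: contrapT => nx1; apply: nx; left; exists t.
have [M' [i [NM iH Bz]]] := n2; set z := tp (- i%:Z) (S x) in Bz.
have zE (t : int) : tp t (S x) = tp (t + i) z by rewrite /z -aut_powD addrK.
have Bm (t : nat) : (t < H)%N -> B m (S (tp t x)) <-> starts q a m (i + t)%N.
  move=> tH; rewrite n1 zE -PoszD addnC; apply: (base_visit HB q_gt1 _ Bz); first lia.
  by lia.
pose f (t : nat) := `[< U (tp t x) >].
have lkn : (n <= N)%N by lia.
have fper r r' o : (r < cuts q n (l + k))%N -> (r' < cuts q n (l + k))%N ->
    (o < h n)%N -> f (start q a n r + o)%N = f (start q a n r' + o)%N.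
  move=> rl rl' oh.
  have aux r1 : (r1 < cuts q n (l + k))%N -> B n (tp (start q a n r1) x).
    move=> rl1; apply/(base_visit HB q_gt1 lkn Bx); last by exists r1.
    have := start_block a q_gt1 rl1; have := height_gt0 a q_gt1 n; rewrite /N; lia.
  have pE r1 : tp (start q a n r1 + o)%N x = tp o (tp (start q a n r1) x).
    by rewrite addnC PoszD aut_powD.
  apply/asbool_equiv_eq; rewrite !pE.
  split; apply: sU (oh); exact: aux.
have := @matching q a q_gt1 A a_le m n l k i f e mn Am hn fper.
rewrite -/N -/H => /(_ _ vary)[|j [dj j1 j2]].
  apply: leq_ltn_trans cx; apply: subset_leq_card; apply/fintype.subsetP => t.
  rewrite !inE /f => ne; apply/asboolP; apply: contrapT => nE'; case/eqP: ne.
  have nE : ~ E (tp t x) by move=> Ex; apply: nE'; apply/asboolP.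
  clear nE'.
  apply/asbool_equiv_eq; have := Bm t (ltn_ord t); move: nE; rewrite /E /setY /=.
  by case: (pselect (U (tp t x))); case: (pselect (B m (S (tp t x)))); tauto.
(* [S x] sits at position [i] of the word and [start q a n j] is the nearby start; as [cuts q n l]
   divides [j], it is also the start of a stage-[n + l] block. *)
exists x, ((start q a n j)%:Z - i%:Z); split => //; first by lia.
rewrite zE subrK.
have -> : start q a n j = start q a (n + l) (j %/ cuts q n l) by
  rewrite -start_muls // divnK.
apply/(base_visit HB q_gt1 _ Bz); last by exists (j %/ cuts q n l)%N.
- by lia.
- rewrite -start_muls // divnK //; have := height_mono a q_gt1 lkn; rewrite -/H.
  have := height_mono a q_gt1 mn; lia.
Qed.


Lemma heightS_le n : (h n.+1 <= M * A.+1 * h n)%N.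
Proof.
have h0 := height_gt0 a q_gt1 n; have qM := q_le n.
have sumle : (\sum_(1 <= i < q n) a n i <= M * A)%N.
  apply: (@leq_trans (\sum_(1 <= i < q n) A)%N).
    rewrite big_nat_cond [leqRHS]big_nat_cond; apply: leq_sum => i.
    by rewrite andbT; exact: a_le.
  by rewrite sum_nat_const_nat leq_mul //; lia.
rewrite /=; apply: leq_trans (leq_add (leq_mul qM (leqnn _)) sumle) _.
have : (M * A <= M * A * h n)%N by rewrite leq_pmulr.
by rewrite mulnS mulnDl; lia.
Qed.

Lemma height_le n l : (h (n + l) <= (M * A.+1) ^ l * h n)%N.
Proof.
elim: l => [|l IH]; first by rewrite addn0 mul1n.
rewrite addnS; apply: leq_trans (heightS_le _) _.
by rewrite expnS -!mulnA !leq_mul2l IH !orbT.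
Qed.

(** With [e = h n %/ (8 * h m)], at least 1 from stage [m + 3] on since heights at least double,
    [h n <= 16 * h m * e]. Then [mass (tower m) <= h (n + K) * mass (B (n + K))] and [height_le]
    bound [e * mass (B (n + K))] below by [mass (tower m) / D]. The factor 8 leaves room for the
    inequality that [spacer_matched] requires. *)
Lemma error_budget m K : (A < h m)%N -> exists2 eps : R, 0 < eps &
  forall n, (m + 3 <= n)%N ->
    eps <= (h n %/ (8 * h m))%:R * mass (B (n + K)%N) /\
    (2 * (h n %/ (8 * h m)) * (h m + A) + 3 * A <= h n)%N.
Proof.
move=> Am; pose D := (16 * h m * (M * A.+1) ^ K)%N.
have hm0 := height_gt0 a q_gt1 m.
have M0 : (0 < M)%N by apply: leq_trans (q_le 0); have := q_gt1 0; lia.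
have D0 : (0 < D)%N by rewrite !muln_gt0 expn_gt0 muln_gt0 M0 hm0.
have D0R : 0 < D%:R :> R by rewrite ltr0n.
exists (mass (tower m) / D%:R).
  rewrite divr_gt0 // mass_tower // mulr_gt0 ?ltr0n //.
  exact: (mass_base_gt0 HB q_gt1).
move=> n mn; set e := (_ %/ _)%N; set N := (n + K)%N.
have hmn : (8 * h m <= h n)%N.
  have := height_ge a q_gt1 m 3; rewrite -[(2 ^ 3)%N]/8%N => /leq_trans; apply.
  exact: height_mono.
have e0 : (0 < e)%N by rewrite divn_gt0 //; lia.
have lte : (h n < e.+1 * (8 * h m))%N by rewrite ltn_ceil //; lia.
have lee : (e * (8 * h m) <= h n)%N by exact: leq_divM.
split; last by nia.
rewrite ler_pdivrMr //; apply: (@le_trans _ _ ((h N)%:R * mass (B N))).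
  rewrite -(mass_tower HB); apply: le_mass; try exact: (measurable_tower HB).
  by apply: (tower_sub HB q_gt1) => //; rewrite /N; lia.
rewrite mulrAC ler_wpM2r ?mass_ge0 // -natrM ler_nat.
apply: leq_trans (height_le n K) _; rewrite /D mulnA mulnC leq_mul2r.
by apply/orP; right; nia.
Qed.

Variable k : nat.
Hypothesis vary : forall N, varying_spacers N k.

(* [window_shift] for [S = T^c] bounds [2 |c|] by [h n + A]; choosing [n] with
   [h n <= |c| < h n.+1] contradicts this. *)
Lemma powers_discrete m : (A < h m)%N -> exists2 eps : R, 0 < eps &
  forall c : int, dist (tp c @^-1` B m) (B m) < eps ->
    dist (tp c @^-1` B (m + 3)%N) (B (m + 3)%N) < eps -> c = 0.
Proof.
move=> Am; have [eps eps0 budget] := error_budget (2 + k) Am.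
pose eps' := Num.min eps (mass (B (m + 3)%N)).
have eps'0 : 0 < eps' by rewrite lt_min eps0 (mass_base_gt0 HB q_gt1).
exists eps' => // c; rewrite !lt_min => /andP[d1 _] /andP[_ d2].
have mB n := base_measurable HB n.
(* A nonzero [c] below the height moves [B (m + 3)] off itself, at distance twice its mass; this is
   why [eps'] is capped by that mass. *)
have [small|big] := ltnP `|c| (h (m + 3)).
  apply: contrapT => c0; move: d2; apply/negP; rewrite -leNgt.
  have mcB : measurable (tp c @^-1` B (m + 3)%N).
    exact: measurable_pre (preserving_pow T c) (mB _).
  rewrite dist_disjoint //.
    by rewrite lerDr mass_ge0.
  apply/seteqP; split => // x [/= Bc Bx]; apply: c0.
  exact: (base_disjointZ HB small Bx Bc).
have [n [mn hn hn1]] : exists n, [/\ (m + 3 <= n)%N,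
  (h n <= `|c|)%N & (`|c| < h n.+1)%N].
  have ex : exists n, (`|c| < h n)%N.
    by exists `|c|%N; exact: ltn_height.
  case: (ex_minnP ex) => n lt min.
  have n3 : (m + 3 < n)%N.
    by rewrite ltnNge; apply/negP => /(height_mono a q_gt1); lia.
  exists n.-1; rewrite prednK; last by lia.
  split => //; first by lia.
  by rewrite leqNgt; apply/negP => /min; lia.
have [bud1 bud2] := budget n mn.
have mn' : (m <= n)%N by lia.
(* Taken with [l = 2]: since [|s| < h n] and [|c| < h n.+1], the return time [s + c] to [B (n + 2)]
   is below [h (n + 2)], hence zero, so [|c| = |s| < h n]. *)
have [x [s [Bx s1 Bs _ _]]] := window_shift (preserving_pow T c)
  (commuting_pow T c) mn' Am bud2 (vary (n + 2)) (mB m)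
  (saturated_base HB q_gt1 mn') (lt_le_trans d1 bud1).
have n2 : (n + 2 <= n + (2 + k))%N by lia.
have Bx2 := base_sub HB q_gt1 n2 Bx.
rewrite -aut_powD in Bs.
have hA : (A < h n)%N by apply: leq_trans Am (height_mono a q_gt1 mn').
have h2 := heightS_ge a q_gt1 n.+1.
have h1 := heightS_ge a q_gt1 n.
have : s + c = 0.
  by apply: (base_disjointZ HB _ Bx2 Bs); rewrite addn2; lia.
by lia.
Qed.

(** One good point controls the whole stage-[n + l] tower. A point at height [t] is in [U] exactly
    when [T^t x] is, and in the translate of [B m] by [z] exactly when [S (T^t x)] is in [B m],
    provided [t - z] is still a height of the tower. The two sets thus differ only outside the
    tower, on the levels of the few errors of [x], and on [|z|] boundary levels. *)
Lemma weak_closure (S : X -> X) m (eta : R) : preserving mu S -> commuting T S ->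
  (A < h m)%N -> 0 < eta ->
  exists s : int, dist (S @^-1` B m) (tp (- s) @^-1` B m) < eta.
Proof.
move=> pS cS Am eta0; have mB n := base_measurable HB n.
have mSB n : measurable (S @^-1` B n) by exact: measurable_pre pS (mB n).
(* As [h (n + l) >= 2 ^ l * h n >= l * h n], any [h n] levels of stage [n + l] have total mass at
   most [eta / 8]; this bounds both the errors and the boundary levels. *)
have [l hl] : exists l : nat, 8 / eta < l%:R.
  by exists (Num.bound (8 / eta)); rewrite archi_boundP // divr_ge0 // ltW.
have [eps eps0 budget] := error_budget (l + k) Am.
have [|s sh sd] := base_dense HB (mSB m) (_ : 0 < Num.min eps (eta / 4)).
  by rewrite lt_min eps0 divr_gt0.
move: sd; set U := \big[setU/set0]_(p <- s) _; rewrite lt_min => /andP[d1 d2].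
have [|N1 full] := tower_full HB q_gt1 (_ : 0 < eta / 4); first by rewrite divr_gt0.
pose n := maxn (m + 3) (maxn N1 (\max_(p <- s) p.1)).
have mn3 : (m + 3 <= n)%N by rewrite /n; lia.
have mn : (m <= n)%N by lia.
have sat n' : (n <= n')%N -> saturated n' U.
  move=> nn'; apply: (saturated_levels HB q_gt1) => p ps; split; first exact: sh.
  have : (p.1 <= \max_(p <- s) p.1)%N by exact: leq_bigmax_seq.
  by rewrite /n in nn'; lia.
have mU : measurable U.
  by apply: bigsetU_measurable => p _; exact: (measurable_lev HB).
have [bud1 bud2] := budget n mn3; set e := (h n %/ _)%N in bud1 bud2.
have [x [z [Bx z1 Bz comm cnt]]] := window_shift pS cS mn Am bud2 (vary (n + l)) mU
  (sat n (leqnn n)) (lt_le_trans d1 bud1).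
exists z; set W := tp (- z) @^-1` B m.
have mW : measurable W by exact: measurable_pre (preserving_pow T _) (mB m).
set E := _ `+` U in cnt; set N := (n + (l + k))%N in Bx cnt.
have nlN : (n + l <= N)%N by rewrite /N; lia.
have hnl := height_mono a q_gt1 nlN.
have hml := height_mono a q_gt1 (leq_addr l n).
have Bx' := base_sub HB q_gt1 nlN Bx.
have z2 : (`|z| <= h n)%N by have := height_mono a q_gt1 mn; lia.
(* Times beyond [h (n + l)] contribute sets that are not levels of the tower; this is harmless, as
   only their number and mass count. *)
pose F1 (t : 'I_(h N)) := if `[< E (tp t x) >] then lev (n + l) t else set0.
(* A shift by [z] leaves the tower from its bottom levels if [z] is positive and from its top levels
   otherwise. *)
pose g j := if (0 <= z)%R then j else ((h (n + l)).-1 - j)%N.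
pose D1 := \big[setU/set0]_(t < h N) F1 t.
pose D2 := \big[setU/set0]_(j < `|z|%N) lev (n + l) (g j).
have mlev j := measurable_lev HB (n + l) j.
have mF1 t : measurable (F1 t) by rewrite /F1; case: ifP.
have mD1 : measurable D1 by exact: bigsetU_measurable.
have mD2 : measurable D2 by exact: bigsetU_measurable.
have mt : measurable (~` tower (n + l)) by apply/measurableC/(measurable_tower HB).
have cover : U `+` W `<=` ~` tower (n + l) `|` (D1 `|` D2).
  move=> w UW; have [tw|] := pselect (tower (n + l) w); last by left.
  right; move: tw => /towerP[t th Bt].
  have [Ex|nEx] := pselect (E (tp t x)).
    left; rewrite /D1 (bigD1 (Ordinal (leq_trans th hnl))) //=; left.
    by rewrite /F1 /= asboolT.
  right; have [[v ev vh]|out] := pselect (exists2 v : nat,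
    t%:Z - z = v & (v < h (n + l))%N).
    exfalso; set x' := tp (- t%:Z) w in Bt.
    have wE : w = tp t x' by rewrite /x' aut_powNK.
    have nlm : (m <= n + l)%N by lia.
    have nln : (n <= n + l)%N by lia.
    have e1 : W w <-> starts q a m v.
      by rewrite /W /= wE -aut_powD addrC ev (base_visit HB q_gt1 nlm Bt).
    have e2 : B m (S (tp t x)) <-> starts q a m v.
      by rewrite comm -(subrK z t%:Z) ev aut_powD (base_visit HB q_gt1 nlm Bz).
    have e3 : U w <-> U (tp t x) by rewrite wE; split; apply: (sat _ nln _ _ t).
    move: nEx UW; rewrite /E /setY /=.
    by case: (pselect (U (tp t x))); case: (pselect (B m (S (tp t x)))); tauto.
  have [j jz gj] : exists2 j : nat, (j < `|z|)%N & g j = t.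
    rewrite /g; have [zt|zt] := leP 0 z.
      exists t => //; rewrite ltnNge; apply/negP => zt'; apply: out.
      by exists (t - `|z|)%N; lia.
    exists ((h (n + l)).-1 - t)%N; last by lia.
    rewrite ltnNge; apply/negP => zt'; apply: out.
    by exists (t + `|z|)%N; lia.
  by rewrite /D2 (bigD1 (Ordinal jz)) //=; left; rewrite gj.
have hR n' : 0 < (h n')%:R :> R by rewrite ltr0n height_gt0.
have massl (j : nat) : (j <= h n)%N -> j%:R * mass (B (n + l)) <= eta / 8.
  move=> jh; apply: (@le_trans _ _ ((h n)%:R * (h (n + l))%:R^-1)).
    by rewrite ler_pM ?ler0n ?mass_ge0 ?ler_nat ?(mass_base_le HB).
  rewrite ler_pdivrMr //.
  have : (l%:R * (h n)%:R <= (h (n + l))%:R :> R).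
    rewrite -natrM ler_nat; apply: leq_trans (height_ge a q_gt1 n l).
    by rewrite leq_mul2r ltnW ?orbT // ltn_expl.
  have := hl; rewrite ltr_pdivrMr // => hl1 hl2.
  have : 0 <= (l%:R * eta - 8) * (h n)%:R by rewrite mulr_ge0 ?ler0n //; lra.
  have : 0 <= eta * ((h (n + l))%:R - l%:R * (h n)%:R) by rewrite mulr_ge0
    ?subr_ge0 // ltW.
  by lra.
have m1 : mass D1 <= eta / 8.
  apply: le_trans (massl e _); last by apply: leq_trans (leq_div _ _) _; lia.
  apply: le_trans (mass_bigsetU_le mu (h N) (F := fun t => if `[< E (tp t x) >]
    then lev (n + l) t else set0) _) _.
    by move=> t; case: ifP.
  apply: (@le_trans _ _ (#|[pred t :
    'I_(h N) | `[< E (tp t x) >]]|%:R * mass (B (n + l)))).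
    rewrite -sum1_card natr_sum mulr_suml [leRHS]big_mkcond /=.
    apply: ler_sum => t _; rewrite inE; case: ifP => _; last by rewrite mass_set0.
    by rewrite (mass_lev HB) mul1r.
  by rewrite ler_wpM2r ?mass_ge0 // ler_nat ltnW.
have m2 : mass D2 <= eta / 8.
  apply: le_trans (massl `|z|%N z2).
  apply: le_trans (mass_bigsetU_le mu `|z|%N (F := fun j => lev (n + l) (g j))
    _) _ => //.
  under eq_bigr do rewrite (mass_lev HB).
  by rewrite sumr_const card_ord mulr_natl.
have m3 : mass (~` tower (n + l)) < eta / 4.
  rewrite mass_setC; last exact: (measurable_tower HB).
  by apply: full; rewrite /n; lia.
apply: le_lt_trans (dist_triangle mu (mSB m) mU mW) _.
have : dist U W <= mass (~` tower (n + l)) + (mass D1 + mass D2).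
  apply: le_trans (le_mass mu (measurable_setY mU mW) _ cover) _.
    by do 2?[apply: measurableU => //].
  apply: le_trans (mass_setU_le mu mt (measurableU _ _ mD1 mD2)) _.
  by rewrite lerD2l mass_setU_le.
by lra.
Qed.

End centralizer.

(** * Comparing maps that commute with the transformation *)

Section commuting_maps.
Context {d} {X : measurableType d} {R : realType} (mu : probability X R).
Variable T : mp_aut mu.

Local Notation tp := (aut_pow T).
Local Notation mass := (mass mu).
Local Notation dist := (dist mu).

Lemma dist_bigsetU (I : Type) (s : seq I) (F G : I -> set X) :
  (forall i, measurable (F i)) -> (forall i, measurable (G i)) ->
  dist (\big[setU/set0]_(i <- s) F i) (\big[setU/set0]_(i <- s) G i) <=
    \sum_(i <- s) dist (F i) (G i).
Proof.
move=> mF mG; elim: s => [|i s IH]; first by rewrite !big_nil distAA.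
rewrite !big_cons; apply: le_trans (lerD (lexx _) IH).
have mFs : measurable (\big[setU/set0]_(j <- s) F j) by exact: bigsetU_measurable.
have mGs : measurable (\big[setU/set0]_(j <- s) G j) by exact: bigsetU_measurable.
have mFG := measurable_setY (mF i) (mG i); have mFGs := measurable_setY mFs mGs.
apply: le_trans (mass_setU_le mu mFG mFGs); apply: le_mass.
- by apply: measurable_setY; apply: measurableU.
- exact: measurableU.
- by move=> x /=; tauto.
Qed.

Lemma preimage_bigsetU (S : X -> X) (I : Type) (s : seq I) (F : I -> set X) :
  S @^-1` (\big[setU/set0]_(i <- s) F i) = \big[setU/set0]_(i <- s) (S @^-1` F i).
Proof. by elim: s => [|i s IH]; rewrite ?big_nil // !big_cons -IH. Qed.

Lemma commutingZ (S : X -> X) : commuting T S ->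
  mu.-negligible [set x | exists z : int, S (tp z x) <> tp z (S x)].
Proof.
move=> cS; have nN := commuting_nat cS; set N := [set x | _] in nN.
apply: (@negligibleS _ _ _ _ (N `|` \bigcup_(k : nat) (tp (- k%:Z) @^-1` N))).
  move=> x [z ne]; have [[k zk]|[k zk]] : (exists k : nat,
    z = k) \/ (exists k : nat, z = - k%:Z).
    by case: z ne => k _; [left; exists k|right; exists k.+1; rewrite NegzE].
  - by left; exists k; rewrite -zk.
  - right; exists k => //; exists k => e; apply: ne; rewrite zk.
    by rewrite aut_powNK in e; rewrite e aut_powK.
apply: negligibleU => //; apply: negligible_bigcup => k.
by apply: negligible_pre nN; exact: preserving_pow.
Qed.

Lemma dist_commute (S : X -> X) z C : preserving mu S -> commuting T S ->
  measurable C -> dist (S @^-1` (tp z @^-1` C)) (tp z @^-1` (S @^-1` C)) = 0.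
Proof.
move=> pS cS mC; have pz := preserving_pow T z.
apply: mass_negligible.
  apply: measurable_setY.
    exact: measurable_pre pS (measurable_pre pz mC).
  exact: measurable_pre pz (measurable_pre pS mC).
apply: negligibleS (commutingZ cS) => x /= ne; exists z => e.
by move: ne; rewrite e /setY /=; tauto.
Qed.

Lemma dist_eq0_trans A B C : measurable A -> measurable B -> measurable C ->
  dist A B = 0 -> dist A C = dist B C.
Proof.
move=> mA mB mC AB; apply/eqP; rewrite eq_le.
have := dist_triangle mu mA mB mC; have := dist_triangle mu mB mA mC.
by rewrite (distC mu B A) AB; lra.
Qed.

(** Both maps commute with [T^z], which preserves distances; so closeness on a base is closeness on
    each of its levels. *)
Lemma dist_pre_pow (S S' : X -> X) z C : preserving mu S -> commuting T S ->
  preserving mu S' -> commuting T S' -> measurable C ->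
  dist (S @^-1` (tp z @^-1` C)) (S' @^-1` (tp z @^-1` C)) =
  dist (S @^-1` C) (S' @^-1` C).
Proof.
move=> pS cS pS' cS' mC; have pz := preserving_pow T z.
have mzC := measurable_pre pz mC.
have mSC := measurable_pre pS mC; have mSC' := measurable_pre pS' mC.
have mSz := measurable_pre pS mzC; have mSz' := measurable_pre pS' mzC.
have mzS := measurable_pre pz mSC; have mzS' := measurable_pre pz mSC'.
rewrite (dist_eq0_trans mSz mzS mSz' (dist_commute z pS cS mC)) distC.
rewrite (dist_eq0_trans mSz' mzS' mzS (dist_commute z pS' cS' mC)).
by rewrite dist_pre // distC.
Qed.

End commuting_maps.

(** * Varying spacers: commuting maps are powers *)

Section trivial.
Context {d} {X : measurableType d} {R : realType} (mu : probability X R).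
Variables (T : mp_aut mu) (q : nat -> nat) (a : nat -> nat -> nat).

Local Notation tp := (aut_pow T).
Local Notation mass := (mass mu).
Local Notation dist := (dist mu).
Local Notation h := (height q a).

Variable B : nat -> set X.
Hypothesis HB : tower_bases T q a B.
Hypothesis q_gt1 : forall n, (1 < q n)%N.

Lemma base_bigsetU n l :
  B n = \big[setU/set0]_(r < cuts q n l) (tp (- (start q a n r)%:Z) @^-1` B (n + l)%N).
Proof.
rewrite -(bigcup_mkord _ (fun r => tp (- (start q a n r)%:Z) @^-1` B (n + l)%N)).
apply/seteqP; split => x.
  by move=> /(base_cuts HB q_gt1 n l)[r rc Br]; exists r.
by move=> [r /= rc Br]; apply/(base_cuts HB q_gt1 n l); exists r.
Qed.

(** [B n] consists of [cuts q n l] translates of [B (n + l)], each contributing the same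
    distance. *)
Lemma dist_base_le (S S' : X -> X) n l : preserving mu S -> commuting T S ->
  preserving mu S' -> commuting T S' ->
  dist (S @^-1` B n) (S' @^-1` B n) <=
    (cuts q n l)%:R * dist (S @^-1` B (n + l)%N) (S' @^-1` B (n + l)%N).
Proof.
move=> pS cS pS' cS'; have mB m := base_measurable HB m.
have mtB z m := measurable_pre (preserving_pow T z) (mB m).
rewrite (base_bigsetU n l) !preimage_bigsetU.
apply: le_trans (dist_bigsetU mu _ _ _) _ => [r|r|].
- exact: measurable_pre pS (mtB _ _).
- exact: measurable_pre pS' (mtB _ _).
- under eq_bigr do rewrite dist_pre_pow //.
  by rewrite sumr_const card_ord mulr_natl.
Qed.

Lemma dist_all0 (S S' : X -> X) : preserving mu S -> commuting T S ->
  preserving mu S' -> commuting T S' ->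
  (forall n, dist (S @^-1` B n) (S' @^-1` B n) = 0) ->
  forall C, measurable C -> dist (S @^-1` C) (S' @^-1` C) = 0.
Proof.
move=> pS cS pS' cS' d0 C mC; have mB m := base_measurable HB m.
have mSC := measurable_pre pS mC; have mSC' := measurable_pre pS' mC.
apply/eqP; rewrite eq_le dist_ge0 andbT; apply/ler_addgt0Pr => e e0; rewrite add0r.
have [|s _] := base_dense HB mC (_ : 0 < e / 2); first by rewrite divr_gt0.
set V := \big[setU/set0]_(p <- s) _ => dV.
have mV : measurable V by apply: bigsetU_measurable => p _; exact: (measurable_lev HB).
have mSV := measurable_pre pS mV; have mSV' := measurable_pre pS' mV.
have VV : dist (S @^-1` V) (S' @^-1` V) <= 0.
  rewrite /V !preimage_bigsetU; apply: le_trans (dist_bigsetU mu _ _ _) _ => [p|p|].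
  - exact: measurable_pre pS (measurable_lev HB _ _).
  - exact: measurable_pre pS' (measurable_lev HB _ _).
  - by rewrite big1 // => p _; rewrite dist_pre_pow.
apply: le_trans (dist_triangle mu mSC mSV mSC') _.
have := dist_triangle mu mSV mSV' mSC'.
rewrite (dist_pre pS) // (dist_pre pS' mV mC) (distC mu V C); move: dV VV.
by rewrite -/dist; lra.
Qed.

Variables M A k : nat.
Hypothesis q_le : forall n, (q n <= M)%N.
Hypothesis a_le : forall n i, (0 < i < q n)%N -> (a n i <= A)%N.
Hypothesis vary : forall N, varying_spacers q a N k.

(** Exponents that are close enough to [S] at a given stage coincide, since their difference nearly
    fixes the two bases in [powers_discrete]. Better and better approximations at that stage
    therefore have one common exponent, whose distance to [S] is zero. *)
Lemma centralizer_pow (S : X -> X) : preserving mu S -> commuting T S ->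
  exists z : int, forall C, measurable C ->
    dist (S @^-1` C) (tp z @^-1` C) = 0.
Proof.
move=> pS cS; have mB m := base_measurable HB m.
have pz z := preserving_pow T z; have cz z := commuting_pow T z.
have Am : (A < h A)%N by exact: ltn_height.
have [eps eps0 discr] := powers_discrete HB q_gt1 q_le a_le vary Am.
pose close n (s : int) := dist (S @^-1` B n) (tp (- s) @^-1` B n).
have down n l s : close n s <= (cuts q n l)%:R * close (n + l)%N s.
  exact: dist_base_le.
have uniq l : exists2 del : R, 0 < del & forall s s', 
    close (A + 3 + l)%N s < del -> close (A + 3 + l)%N s' < del -> s = s'.
  (* [K] dominates both factors lost in descending from stage [A + 3 + l] to the stages [A] and
     [A + 3], where discreteness is applied. *)
  pose K : R := (cuts q A (3 + l) + cuts q (A + 3) l)%:R.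
  have K0 : 0 < K by rewrite ltr0n addn_gt0 cuts_gt0.
  exists (eps / (2 * K)) => [|s s' h1 h2].
    by rewrite divr_gt0 // mulr_gt0.
  have half n j s1 : (n + j = A + 3 + l)%N -> (cuts q n j)%:R <= K ->
      close (A + 3 + l)%N s1 < eps / (2 * K) -> close n s1 < eps / 2.
    move=> <- jK lt; apply: le_lt_trans (down n j s1) _.
    apply: (@le_lt_trans _ _ (K * close (n + j)%N s1)).
      by rewrite ler_wpM2r ?dist_ge0.
    have -> : eps / 2 = K * (eps / (2 * K)) 
      by rewrite invfM mulrCA [K * _]mulrCA mulfV ?mulr1 // gt_eqF.
    by rewrite ltr_pM2l.
  suff : s - s' = 0 by lia.
  have cl n s1 s2 : close n s1 < eps / 2 -> close n s2 < eps / 2 ->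
      dist (tp (s1 - s2) @^-1` B n) (B n) < eps.
    move=> lt1 lt2; rewrite -(dist_pre (pz (- s1))) //; last first.
      exact: measurable_pre (pz _) (mB _).
    have -> : tp (- s1) @^-1` (tp (s1 - s2) @^-1` B n) = tp (- s2) @^-1` B n.
      by apply/seteqP; split => x /=; rewrite -aut_powD addrAC subrr add0r.
    have m1 := measurable_pre (pz (- s1)) (mB n).
    have m2 := measurable_pre (pz (- s2)) (mB n).
    have mS := measurable_pre pS (mB n).
    apply: le_lt_trans (dist_triangle mu m2 mS m1) _.
    by rewrite distC; move: lt1 lt2; rewrite /close; lra.
  apply: discr; apply: cl.
  - by apply: (half _ (3 + l)%N) h1; rewrite ?addnA // /K ler_nat leq_addr.
  - by apply: (half _ (3 + l)%N) h2; rewrite ?addnA // /K ler_nat leq_addr.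
  - by apply: (half _ l) h1; rewrite // /K ler_nat leq_addl.
  - by apply: (half _ l) h2; rewrite // /K ler_nat leq_addl.
have exact0 l : exists s, close (A + 3 + l)%N s = 0.
  have [del del0 un] := uniq l.
  have Al : (A < h (A + 3 + l))%N.
    by apply: leq_trans Am (height_mono _ _ _) => //; lia.
  have [s hs] := weak_closure HB q_gt1 q_le a_le vary pS cS Al del0.
  exists s; apply/eqP; rewrite eq_le dist_ge0 andbT; apply/ler_addgt0Pr => e e0.
  have [|s' hs'] := weak_closure HB q_gt1 q_le a_le vary pS cS Al
    (_ : 0 < Num.min e del); first by rewrite lt_min e0.
  move: hs'; rewrite lt_min => /andP[h1 h2].
  by rewrite (un _ _ hs h2) add0r ltW.
have [s0 hs0] := exact0 0%N.
exists (- s0); apply: dist_all0 => // n.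
suff big l : close (A + 3 + l)%N s0 = 0.
  apply/eqP; rewrite eq_le dist_ge0 andbT.
  by have := down n (A + 3)%N s0; rewrite [(n + _)%N]addnC big mulr0.
have [s hs] := exact0 l.
have [del del0 un] := uniq 0%N.
(* Equality at a late stage descends to the stage of [s0], where the exponent is unique, so one
   exponent serves all stages. *)
suff -> : s0 = s by [].
apply: un; first by rewrite hs0.
apply: le_lt_trans (down _ l s) _; by rewrite !addn0 hs mulr0.
Qed.

End trivial.

(** * Limits of measure preserving maps *)

Section limit_map.
Context {d} {X : measurableType d} {R : realType} (mu : probability X R).

Local Notation mass := (mass mu).
Local Notation dist := (dist mu).

Lemma negligible_small (N : set X) :
  (forall e : R, 0 < e -> exists U, [/\ measurable U, N `<=` U & mass U <= e]) ->
  mu.-negligible N.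
Proof.
move=> small.
have /choice[U HU] : forall n : nat, exists U,
    [/\ measurable U, N `<=` U & mass U <= (n.+1%:R : R)^-1].
  by move=> n; apply: small; rewrite invr_gt0.
have mU : measurable (\bigcap_n U n).
  by apply: bigcapT_measurable => n; have [] := HU n.
apply: (@negligibleS _ _ _ _ (\bigcap_n U n)).
  by move=> x Nx n _; have [_ + _] := HU n; apply.
apply: negligible_mass => //; apply/ler_addgt0Pr => e e0; rewrite add0r.
pose n := Num.bound e^-1; have [mUn _ le] := HU n.
apply: le_trans (le_mass mu mU mUn _) _; first by move=> x; apply.
apply: le_trans le _; rewrite -[leRHS]invrK lef_pV2 ?posrE ?invr_gt0 //.
have : e^-1 < n%:R by rewrite archi_boundP // invr_ge0 ltW.
by move=> /ltW/le_trans; apply; rewrite ler_nat.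
Qed.

(** The union of the inner sets misses only a negligible part of [E], and completeness makes that
    part measurable. *)
Lemma measurable_sandwich (E : set X) : measure_is_complete mu ->
  (forall e : R, 0 < e -> exists L U,
    [/\ measurable L, measurable U, L `<=` E, E `<=` U & mass U - mass L <= e]) ->
  measurable E.
Proof.
move=> cmu sand.
have /choice[L HL] : forall n : nat, exists L, exists U,
    [/\ measurable L, measurable U, L `<=` E,
      E `<=` U & mass U - mass L <= (n.+1%:R : R)^-1].
  by move=> n; apply: sand; rewrite invr_gt0.
have mL n : measurable (L n) by have [U []] := HL n.
have mUL : measurable (\bigcup_n L n) by exact: bigcupT_measurable.
have subE : \bigcup_n L n `<=` E by move=> x [n _]; have [U [_ _ + _ _]] := HL n; apply.
have nD : mu.-negligible (E `\` \bigcup_n L n).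
  apply: negligible_small => e e0; pose n := Num.bound e^-1.
  have [U [_ mU LE EU le]] := HL n; exists (U `\` L n); split.
  - exact: measurableD.
  - by move=> x [Ex nx]; split; [exact: EU|move=> Lx; apply: nx; exists n].
  - have : mass (U `\` L n) + mass (L n) <= mass U.
      rewrite -mass_setU //.
      + by apply: le_mass => //; [apply: measurableU => //; exact: measurableD|
          move=> x [[]//|/LE/EU]].
      + exact: measurableD.
      + by apply/seteqP; split => // x [[]].
    have : (n.+1%:R : R)^-1 <= e.
      rewrite -[leRHS]invrK lef_pV2 ?posrE ?invr_gt0 //.
      have : e^-1 < n%:R by rewrite archi_boundP // invr_ge0 ltW.
      by move=> /ltW/le_trans; apply; rewrite ler_nat.
    by move=> /(le_trans le) le1 le2; apply: le_trans le1; rewrite lerBrDr.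
have -> : E = \bigcup_n L n `|` (E `\` \bigcup_n L n).
  by apply/esym/setDUK.
by apply: measurableU => //; exact: cmu.
Qed.

(** Used for the sublevel sets of [psi] and of the limit coordinate. Endpoints outside the unit
    interval are allowed because covering intervals may exceed it. *)
Lemma uniform_increment (D : R -> set X) l r : (forall t, measurable (D t)) ->
  (forall t t', t <= t' -> D t `<=` D t') -> (forall t, t < 0 -> D t = set0) ->
  (forall t, 1 <= t -> D t = D 1) -> (forall t, 0 <= t <= 1 -> mass (D t) = t) ->
  l <= r -> mass (D r `\` D l) <= r - l.
Proof.
move=> mD Dmono D0 D1 Dmass lr.
have [r0|r0] := ltP r 0; first by rewrite D0 // set0D mass_set0 subr_ge0.
have [l1|l1] := leP 1 l.
  by rewrite D1 ?(le_trans l1) // (D1 l) // setDv mass_set0 subr_ge0.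
pose r' := Num.min r 1.
have r'01 : 0 <= r' <= 1 by rewrite /r' le_min r0 ler01 ge_min lexx orbT.
have r'r : r' <= r by rewrite /r' ge_min lexx.
have -> : D r = D r' by rewrite /r'; case: (leP r 1) => // /ltW/D1.
have mDD := measurableD (mD r') (mD l).
have [l0|l0] := ltP l 0.
  by rewrite (D0 l) // setD0 Dmass //; lra.
have lr' : l <= r' by rewrite /r' le_min lr ltW.
have : mass (D r' `\` D l) + mass (D l) <= mass (D r').
  rewrite -mass_setU //; last by apply/seteqP; split => // x [[]].
  apply: le_mass => //; first exact: measurableU.
  by move=> x [[]|/(Dmono _ _ lr')].
have l01 : 0 <= l <= 1 by rewrite l0 ltW.
by rewrite (Dmass r' r'01) (Dmass l l01); lra.
Qed.

(** What the construction of limits needs from a Lebesgue space: an almost everywhere injective,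
    uniformly distributed real coordinate. Outer regularity and nullity of the omitted values are
    given by countable covers with half-open intervals, whose preimages are differences of sublevel
    sets. *)
Record coordinate (X0 : set X) (psi : X -> R) : Prop := Coordinate {
  coord_dom : measurable X0 ;
  coord_full : mass X0 = 1 ;
  coord_inj : forall x y, X0 x -> X0 y -> psi x = psi y -> x = y ;
  coord_range : forall x, X0 x -> 0 <= psi x <= 1 ;
  coord_measurable : forall t, measurable (X0 `&` [set x | psi x <= t]) ;
  coord_mass : forall t, 0 <= t <= 1 -> mass (X0 `&` [set x | psi x <= t]) = t ;
  coord_cover : forall A e, measurable A -> 0 < e -> exists l r : nat -> R,
    [/\ forall i, l i <= r i,
        forall x, X0 x -> A x -> exists i, l i < psi x <= r i &
        forall n, \sum_(i < n) (r i - l i) <= mass A + e] ;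
  coord_null : forall e, 0 < e -> exists l r : nat -> R,
    [/\ forall i, l i <= r i,
        forall y, 0 <= y <= 1 -> ~ (psi @` X0) y -> exists i, l i < y <= r i &
        forall n, \sum_(i < n) (r i - l i) <= e]
}.

Variables (X0 : set X) (psi : X -> R).
Hypothesis co : coordinate X0 psi.

Definition below t := X0 `&` [set x | psi x <= t].

Lemma measurable_coord_dom : measurable X0. Proof. exact: coord_dom co. Qed.

Lemma negligible_domC : mu.-negligible (~` X0).
Proof.
apply: negligible_mass; first exact/measurableC/measurable_coord_dom.
by rewrite mass_setC ?(coord_full co) ?subrr //; exact: measurable_coord_dom.
Qed.

Definition rat_enum (j : nat) : R := ratr (odflt 0 (unpickle j : option rat)).

Lemma rat_enum_between (x y : R) : x < y -> exists j, x < rat_enum j < y.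
Proof.
move=> /rat_in_itvoo[r]; rewrite in_itv /= => ry.
by exists (pickle r); rewrite /rat_enum pickleK.
Qed.

Lemma measurable_below t : measurable (below t).
Proof. exact: coord_measurable co t. Qed.

Lemma below_sub t t' : t <= t' -> below t `<=` below t'.
Proof. by move=> tt' x [X0x /= le]; split => //=; exact: le_trans tt'. Qed.

(** Two points of [X0] are separated by a rational value of the coordinate, so countably many sets
    detect where the maps differ. *)
Lemma ae_eq_of_dist (S S' : X -> X) : preserving mu S -> preserving mu S' ->
  (forall A, measurable A -> dist (S @^-1` A) (S' @^-1` A) = 0) ->
  mu.-negligible [set x | S x <> S' x].
Proof.
move=> pS pS' d0.
pose N := \bigcup_j (S @^-1` below (rat_enum j) `+` S' @^-1` below (rat_enum j)).
apply: (@negligibleS _ _ _ _ (S @^-1` (~` X0) `|` S' @^-1` (~` X0) `|` N)).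
  move=> x /= ne; have [Sx|] := pselect (X0 (S x)); last by left; left.
  have [Sx'|] := pselect (X0 (S' x)); last by left; right.
  right; have [lt|lt|] := ltgtP (psi (S x)) (psi (S' x)).
  - have [j /andP[j1 j2]] := rat_enum_between lt; exists j => //; left.
    split; first by split => //=; exact: ltW.
    by move=> [_ /=]; rewrite leNgt j2.
  - have [j /andP[j1 j2]] := rat_enum_between lt; exists j => //; right.
    split; first by split => //=; exact: ltW.
    by move=> [_ /=]; rewrite leNgt j2.
  - by move=> /(coord_inj co Sx Sx') /ne.
apply: negligibleU; first by apply: negligibleU; apply: negligible_pre negligible_domC.
apply: negligible_bigcup => j; have mF := measurable_below (rat_enum j).
apply: negligible_mass; last by rewrite -/(dist _ _) d0.
by apply: measurable_setY; [exact: measurable_pre pS mF|exact: measurable_pre pS' mF].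
Qed.

Lemma below_lt0 t : t < 0 -> below t = set0.
Proof.
move=> t0; apply/seteqP; split => // x [X0x /= le].
by have /andP[/le_trans/(_ le)] := coord_range co X0x; rewrite leNgt t0.
Qed.

Lemma below_ge1 t : 1 <= t -> below t = X0.
Proof.
move=> t1; apply/seteqP; split => x; first by case.
move=> X0x; split => //=; have /andP[_ le] := coord_range co X0x.
exact: le_trans t1.
Qed.

(** * The point map to which a summably Cauchy sequence converges *)

Variable G : nat -> X -> X.
Hypothesis pG : forall k, preserving mu (G k).
Hypothesis Gd : forall k j, (j <= k)%N ->
  dist (G k.+1 @^-1` below (rat_enum j)) (G k @^-1` below (rat_enum j)) <= 2^-1 ^+ k.
Hypothesis cmu : measure_is_complete mu.

Local Notation F := (fun j => below (rat_enum j)).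

Definition eventually_below j := \bigcup_K \bigcap_(k in [set k | (K <= k)%N])
  (G k @^-1` F j).

Local Notation Phi := eventually_below.

Lemma measurable_pre_below k j : measurable (G k @^-1` F j).
Proof. exact: measurable_pre (pG k) (measurable_below _). Qed.

Lemma measurable_eventually j : measurable (Phi j).
Proof.
apply: bigcupT_measurable => K; apply: bigcap_measurable => [|k _];
  last exact: measurable_pre_below.
by exists K => /=.
Qed.

Lemma dist_eventually j k : (j <= k)%N -> dist (Phi j) (G k @^-1` F j) <= 2 * 2^-1 ^+ k.
Proof.
move=> jk; pose D i := G (k + i).+1 @^-1` F j `+` G (k + i)%N @^-1` F j.
have mD i : measurable (D i) by apply: measurable_setY; exact: measurable_pre_below.
apply: (@le_trans _ _ (mass (\bigcup_i D i))).
  apply: le_mass.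
  - apply: measurable_setY; [exact: measurable_eventually|exact: measurable_pre_below].
  - exact: bigcupT_measurable.
  - move=> x Px; apply: contrapT => nD.
    have const i : F j (G (k + i)%N x) <-> F j (G k x).
      elim: i => [|i IH]; first by rewrite addn0.
      rewrite addnS -IH; split => Fx; apply: contrapT => nFx; apply: nD; exists i => //.
        by left.
      by right.
    have : Phi j x <-> F j (G k x).
      split => [[K _ HK]|Fx]; last first.
        by exists k => // i /= /subnKC <-; apply/const.
      have := HK (k + K)%N; rewrite /= leq_addl => /(_ isT) HK'.
      exact/(const K).
    by move: Px; rewrite /setY /=; tauto.
apply: mass_bigcup_le => // n.
apply: (@le_trans _ _ (2^-1 ^+ k * \sum_(i < n) 2^-1 ^+ i)).
  rewrite mulr_sumr; apply: ler_sum => i _; rewrite -exprD; apply: Gd.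
  by rewrite (leq_trans jk) // leq_addr.
rewrite mulrC ler_wpM2r ?exprn_ge0 //.
have := subrX1 (2^-1 : R) n; have : 0 <= (2^-1 : R) ^+ n by rewrite exprn_ge0.
by lra.
Qed.

Lemma geometric_small (e : R) : 0 < e -> exists K, forall k,
  (K <= k)%N -> 2 * 2^-1 ^+ k < e.
Proof.
move=> e0; exists (Num.bound (2 / e)) => k Kk.
rewrite exprVn ltr_pdivrMr ?exprn_gt0 // mulrC -ltr_pdivrMr //.
have : 2 / e < (Num.bound (2 / e))%:R by rewrite archi_boundP // divr_ge0 // ltW.
move=> /lt_le_trans; apply; rewrite -natrX ler_nat (leq_trans Kk) //.
exact/ltnW/ltn_expl.
Qed.

Lemma mass_eventually j : mass (Phi j) = mass (F j).
Proof.
have mP := measurable_eventually j; have mF := measurable_below (rat_enum j).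
suff : `|mass (Phi j) - mass (F j)| <= 0 by rewrite normr_le0 subr_eq0 => /eqP.
apply/ler_addgt0Pr => e e0; rewrite add0r.
have [K HK] := geometric_small e0; pose k := maxn K j.
have := dist_eventually (leq_maxr K j); have := HK k (leq_maxl K j); rewrite -/k.
have mG := measurable_pre_below k j; rewrite -(mass_pre (pG k) mF).
have := mass_dist mu mP mG; have := mass_dist mu mG mP; rewrite (distC mu _ (Phi j)).
by rewrite ler_norml; lra.
Qed.

(** The value 1 is included so that the set is never empty and its infimum is at most 1. *)
Definition coordinate_values x := [set t | t = 1 \/ exists2 j,
  Phi j x & t = rat_enum j].

(* The limit [S] of the maps [G k] is reconstructed from its coordinate: [Phi j]
   is the almost sure limit of [G k @^-1` F j], so [psi (S x)] has to be the
   infimum of the rationals [rat_enum j] with [Phi j x]. *)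
Definition limit_coordinate x := inf (coordinate_values x).

Local Notation f := limit_coordinate.

Lemma eventually_ge0 j x : Phi j x -> 0 <= rat_enum j.
Proof.
move=> [K _ /(_ K (leqnn K))]; rewrite /= => Fx.
by rewrite leNgt; apply/negP => /below_lt0 e; rewrite e in Fx.
Qed.

Lemma coordinate_values_lb x : lbound (coordinate_values x) 0.
Proof. by move=> t [->|[j Pj ->]]; [exact: ler01|exact: eventually_ge0 Pj]. Qed.

Lemma limit_coordinate_ge0 x : 0 <= f x.
Proof. by apply: lb_le_inf; [exists 1; left|exact: coordinate_values_lb]. Qed.

Lemma limit_coordinate_le1 x : f x <= 1.
Proof. by apply: ge_inf; [exists 0; exact: coordinate_values_lb|left]. Qed.

Lemma limit_coordinate_le j x : Phi j x -> f x <= rat_enum j.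
Proof.
move=> Pj; apply: ge_inf; first by exists 0; exact: coordinate_values_lb.
by right; exists j.
Qed.

Lemma eventually_mono i j : rat_enum i <= rat_enum j -> Phi i `<=` Phi j.
Proof.
move=> ij x [K _ HK]; exists K => // k Kk; apply: below_sub ij _ _.
exact: HK.
Qed.

Lemma limit_coordinate_lt t x : f x < t -> t <= 1 -> exists2 j,
  rat_enum j < t & Phi j x.
Proof.
move=> lt t1; have [|u [->|[j Pj ->]] ut] := inf_lt _ lt; first by exists 1; left.
  by have := lt_le_trans ut t1; rewrite ltxx.
by exists j.
Qed.

Lemma measurable_limit_coordinate_lt t : measurable [set x | f x < t].
Proof.
have [t1|t1] := ltP 1 t.
  rewrite (_ : [set x | _] = setT) //; apply/seteqP; split => // x _ /=.
  exact: le_lt_trans (limit_coordinate_le1 x) t1.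
rewrite (_ : [set x | _] = \bigcup_(j in [set j | rat_enum j < t]) Phi j).
  by apply: bigcup_measurable => j _; exact: measurable_eventually.
apply/seteqP; split => x /=.
  by move=> lt; have [j jt Pj] := limit_coordinate_lt lt t1; exists j.
by move=> [j /= jt /limit_coordinate_le le]; exact: le_lt_trans jt.
Qed.

Lemma measurable_limit_coordinate_le t : measurable [set x | f x <= t].
Proof.
rewrite (_ : [set x | _] = \bigcap_(j in [set j | t < rat_enum j]) [set x | f x
  < rat_enum j]).
  apply: bigcap_measurable => [|j _]; last exact: measurable_limit_coordinate_lt.
  have /rat_enum_between[j /andP[tj _]] : t < t + 1 by rewrite ltrDl.
  by exists j.
apply/seteqP; split => x /=.
  by move=> le j /= tj; exact: le_lt_trans tj.
move=> all; rewrite leNgt; apply/negP => lt.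
have [j /andP[tj jf]] := rat_enum_between lt.
by have /= := all j tj; rewrite ltNge (ltW jf).
Qed.

(** The sublevel set is squeezed between sets [Phi j] with rationals just below and just above [t],
    whose masses are those rationals. *)
Lemma mass_limit_coordinate_le t : 0 <= t <= 1 -> mass [set x | f x <= t] = t.
Proof.
move=> /andP[t0 t1]; have mt := measurable_limit_coordinate_le t; apply/eqP;
  rewrite eq_le.
apply/andP; split.
  have [->|t1'] := eqVneq t 1; first by apply: mass_le1;
    exact: measurable_limit_coordinate_le.
  apply/ler_addgt0Pr => e e0.
  have [|j /andP[tj je]] := @rat_enum_between t (Num.min 1 (t + e)).
    by rewrite lt_min ltrDl e0 lt_neqAle t1' t1.
  move: je; rewrite lt_min => /andP[j1 je].
  apply: le_trans (ltW je); rewrite -[leRHS](coord_mass co (t := rat_enum j)).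
    rewrite -/(below _) -mass_eventually; apply: le_mass => //;
      first exact: measurable_eventually.
    move=> x /= le; have [|i ij Pi] := limit_coordinate_lt (le_lt_trans le tj);
      first exact: ltW.
    by apply: eventually_mono Pi; exact: ltW.
  by rewrite (ltW j1) andbT (le_trans t0) // ltW.
have [t00|t0'] := eqVneq t 0; first by rewrite [leLHS]t00 mass_ge0.
rewrite leNgt; apply/negP => lt.
have [|j /andP[tj je]] := @rat_enum_between (mass [set x | f x <= t]) t; first by [].
move: (tj); apply/negP; rewrite -leNgt.
rewrite -[leLHS](coord_mass co (t := rat_enum j)).
  rewrite -/(below _) -mass_eventually; apply: le_mass => //;
    first exact: measurable_eventually.
  by move=> x /limit_coordinate_le /le_trans; apply; exact: ltW.
apply/andP; split; last by rewrite (le_trans (ltW je)).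
by apply: ltW; apply: le_lt_trans tj; exact: mass_ge0.
Qed.

Definition limit_coordinate_between l r := [set x | l < f x <= r].

Lemma limit_coordinate_betweenE l r :
  limit_coordinate_between l r = [set x | f x <= r] `\` [set x | f x <= l].
Proof.
apply/seteqP; split => x /=.
  by move=> /andP[lx xr]; split => //; apply/negP; rewrite -ltNge.
by move=> [xr /negP]; rewrite -ltNge => lx; rewrite /limit_coordinate_between /= lx.
Qed.

Lemma measurable_limit_coordinate_between l r :
  measurable (limit_coordinate_between l r).
Proof. by rewrite limit_coordinate_betweenE; apply: measurableD;
  exact: measurable_limit_coordinate_le. Qed.

Lemma mass_limit_coordinate_between l r :
  l <= r -> mass (limit_coordinate_between l r) <= r - l.
Proof.
move=> lr; rewrite limit_coordinate_betweenE.
apply: (uniform_increment (D := fun t => [set x | f x <= t])) lr.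
- exact: measurable_limit_coordinate_le.
- by move=> t t' tt' x /= /le_trans; apply.
- move=> t t0; apply/seteqP; split => // x /= /le_lt_trans/(_ t0).
  by rewrite ltNge limit_coordinate_ge0.
- move=> t t1; apply/seteqP; split => x _ /=; first exact: limit_coordinate_le1.
  exact: le_trans (limit_coordinate_le1 x) t1.
- exact: mass_limit_coordinate_le.
Qed.

(** The point with coordinate [f x]; where no point of [X0] has that coordinate, a null set by
    [negligible_outside], the value is [x] itself. *)
Definition limit_fun x :=
  if pselect (exists2 z, X0 z & psi z = f x) is left w then projT1 (cid2 w) else x.

Local Notation S := limit_fun.

Lemma limit_funP x : (psi @` X0) (f x) -> X0 (S x) /\ psi (S x) = f x.
Proof.
rewrite /limit_fun => im; case: pselect => // w.
by have [] := projT2 (cid2 w).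
Qed.

Lemma negligible_outside : mu.-negligible [set x | ~ (psi @` X0) (f x)].
Proof.
apply: negligible_small => e /(coord_null co)[l [r [lr cov sum]]].
exists (\bigcup_i limit_coordinate_between (l i) (r i)); split.
- by apply: bigcupT_measurable => i; exact: measurable_limit_coordinate_between.
- move=> x /= nx; have [|i lxr] := cov _ _ nx;
  first by rewrite limit_coordinate_ge0 limit_coordinate_le1.
  by exists i.
- apply: mass_bigcup_le => [i|n]; first exact: measurable_limit_coordinate_between.
  by apply: le_trans (sum n); apply: ler_sum => i _;
    exact: mass_limit_coordinate_between.
Qed.

Lemma limit_fun_cover A e : measurable A -> 0 < e -> exists U,
  [/\ measurable U, mass U <= mass A + e &
    forall x, (psi @` X0) (f x) -> A (S x) -> U x].
Proof.
move=> mA e0; have [l [r [lr cov sum]]] := coord_cover co mA e0.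
exists (\bigcup_i limit_coordinate_between (l i) (r i)); split.
- by apply: bigcupT_measurable => i; exact: measurable_limit_coordinate_between.
- apply: mass_bigcup_le => [i|n]; first exact: measurable_limit_coordinate_between.
  by apply: le_trans (sum n); apply: ler_sum => i _;
    exact: mass_limit_coordinate_between.
- move=> x /limit_funP[X0S e1] AS; have [i] := cov _ X0S AS.
  by rewrite e1; exists i.
Qed.

(** Interval covers bound preimages only from above; the lower bound comes from covering the
    complement of [A]. *)
Lemma limit_fun_sandwich A e : measurable A -> 0 < e -> exists L U,
  [/\ measurable L /\ measurable U, L `<=` S @^-1` A, S @^-1` A `<=` U,
    mass A - e <= mass L & mass U <= mass A + e].
Proof.
move=> mA e0; have [Z [mZ Z0 outZ]] := negligible_outside.
have mZ0 : mass Z = 0 by exact: (congr1 fine Z0).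
have [U [mU Ule AU]] := limit_fun_cover mA e0.
have [V [mV Vle AV]] := limit_fun_cover (measurableC mA) e0.
have mVZ := measurableU _ _ mV mZ; have mUZ := measurableU _ _ mU mZ.
exists (~` (V `|` Z)), (U `|` Z); split.
- by split => //; exact: measurableC.
- move=> x nVZ; apply: contrapT => nA; apply: nVZ.
  have [im|nim] := pselect ((psi @` X0) (f x)); last by right; exact: outZ.
  by left; exact: AV.
- move=> x Ax; have [im|nim] := pselect ((psi @` X0) (f x)); last by right; exact: outZ.
  by left; exact: AU.
- rewrite mass_setC //; have := mass_setU_le mu mV mZ.
  by rewrite (mass_setC mu mA) in Vle; lra.
- by have := mass_setU_le mu mU mZ; lra.
Qed.

Lemma preserving_limit_fun : preserving mu S.
Proof.
have mS A : measurable A -> measurable (S @^-1` A).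
  move=> mA; apply: measurable_sandwich cmu _ => e e0.
  have [|L [U [[mL mU] LS SU l u]]] := @limit_fun_sandwich A (e / 2) mA.
    by rewrite divr_gt0.
  by exists L, U; split => //; lra.
split=> [_ A mA|A mA]; first by rewrite setTI; exact: mS.
have mSA := mS _ mA; rewrite (massE mu mSA) (massE mu mA); congr EFin.
suff : `|mass (S @^-1` A) - mass A| <= 0 by rewrite normr_le0 subr_eq0 => /eqP.
apply/ler_addgt0Pr => e e0; rewrite add0r.
have [L [U [[mL mU] LS SU l u]]] := limit_fun_sandwich mA e0.
have := le_mass mu mL mSA LS; have := le_mass mu mSA mU SU.
by rewrite ler_norml; lra.
Qed.

(** Convergence of [G k] to [S] tested on [A]. These sets are closed under complements, finite
    unions and limits in measure, so it suffices to reach the sublevel sets of [psi]. *)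
Definition approximated A := forall e, 0 < e -> exists K, forall k, (K <= k)%N ->
  dist (S @^-1` A) (G k @^-1` A) < e.

Lemma measurable_pre_limit A : measurable A -> measurable (S @^-1` A).
Proof. exact: measurable_pre preserving_limit_fun. Qed.

Lemma measurable_pre_seq k A : measurable A -> measurable (G k @^-1` A).
Proof. exact: measurable_pre (pG k). Qed.

Lemma approximated_limit A : measurable A ->
  (forall e, 0 < e -> exists A', [/\ measurable A', approximated A' & dist A A' < e]) ->
  approximated A.
Proof.
move=> mA lim e e0.
have [|A' [mA' appA' dA]] := lim (e / 3); first by rewrite divr_gt0.
have [|K HK] := appA' (e / 3); first by rewrite divr_gt0.
exists K => k /HK lt.
have := dist_triangle mu (measurable_pre_limit mA) (measurable_pre_limit mA')
  (measurable_pre_seq k mA).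
have := dist_triangle mu (measurable_pre_limit mA') (measurable_pre_seq k mA')
  (measurable_pre_seq k mA).
rewrite (dist_pre preserving_limit_fun) // (dist_pre (pG k) mA' mA).
by rewrite (distC mu A' A); lra.
Qed.

Lemma approximatedC A : measurable A -> approximated A -> approximated (~` A).
Proof.
move=> mA app e /app[K HK]; exists K => k /HK; apply: le_lt_trans.
apply: le_mass; last first.
- by move=> x /=; case: (pselect (A (S x))); case: (pselect (A (G k x))); tauto.
- exact: measurable_setY (measurable_pre_limit mA) (measurable_pre_seq k mA).
- have mC := measurableC mA; exact:
  measurable_setY (measurable_pre_limit mC) (measurable_pre_seq k mC).
Qed.

Lemma approximatedU A A' : measurable A -> measurable A' ->
  approximated A -> approximated A' -> approximated (A `|` A').
Proof.
move=> mA mA' app app' e e0.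
have [|K HK] := app (e / 2); first by rewrite divr_gt0.
have [|K' HK'] := app' (e / 2); first by rewrite divr_gt0.
exists (maxn K K') => k Kk.
have := HK k (leq_trans (leq_maxl _ _) Kk).
have := HK' k (leq_trans (leq_maxr _ _) Kk).
have m1 := measurable_setY (measurable_pre_limit mA) (measurable_pre_seq k mA).
have m2 := measurable_setY (measurable_pre_limit mA') (measurable_pre_seq k mA').
suff : dist (S @^-1` (A `|` A')) (G k @^-1` (A `|` A')) <=
  dist (S @^-1` A) (G k @^-1` A) + dist (S @^-1` A') (G k @^-1` A') by lra.
apply: le_trans (mass_setU_le mu m1 m2); apply: le_mass.
- by apply: measurable_setY; [apply: measurable_pre_limit|apply:
  measurable_pre_seq]; exact: measurableU.
- exact: measurableU.
- by move=> x /=; tauto.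
Qed.

Lemma approximated_bigsetU n (E : nat -> set X) : (forall i, measurable (E i)) ->
  (forall i, approximated (E i)) -> approximated (\big[setU/set0]_(i < n) E i).
Proof.
move=> mE app; elim: n => [|n IH].
  by move=> e e0; rewrite big_ord0; exists 0%N => k _; rewrite !preimage_set0 distAA.
rewrite big_ord_recr /=; apply: approximatedU => //.
exact: bigsetU_measurable.
Qed.

Lemma approximated_rat j : 0 <= rat_enum j <= 1 -> approximated (F j).
Proof.
move=> j01 e e0; have [K HK] := geometric_small e0.
have mF := measurable_below (rat_enum j); have mP := measurable_eventually j.
have mle := measurable_limit_coordinate_le (rat_enum j).
exists (maxn K j) => k Kk; apply: le_lt_trans (HK k _); last first.
  exact: leq_trans (leq_maxl _ _) Kk.
apply: le_trans (dist_eventually (leq_trans (leq_maxr K j) Kk)).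
rewrite (@dist_eq0_trans _ _ _ mu _ (Phi j)) //.
- exact: measurable_pre_limit.
- exact: measurable_pre_below.
pose D := [set x | f x <= rat_enum j] `\` Phi j.
have mD : measurable D by exact: measurableD.
have D0 : mass D <= 0.
  have : mass (Phi j) + mass D <= mass [set x | f x <= rat_enum j].
    rewrite -mass_setU //; last by apply/seteqP; split => // x [Px []].
    apply: le_mass => //; first exact: measurableU.
    by move=> x [/limit_coordinate_le|[]].
  by rewrite mass_eventually mass_limit_coordinate_le // (coord_mass co j01); lra.
apply: mass_negligible; first by apply: measurable_setY => //;
  exact: measurable_pre_limit.
apply: negligibleS (negligibleU negligible_outside (negligible_mass mD D0)) => x.
have [im|nim] := pselect ((psi @` X0) (f x)); last by left.
have [X0S e1] := limit_funP im.
have SF : F j (S x) <-> f x <= rat_enum j by rewrite /below /= e1; tauto.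
have := @limit_coordinate_le j x; rewrite /D /setY /=.
by right; tauto.
Qed.

Lemma dist_below t t' : 0 <= t -> t <= t' -> t' <= 1 -> dist (below t) (below
  t') <= t' - t.
Proof.
move=> t0 tt' t1; have mt := measurable_below t; have mt' := measurable_below t'.
have : mass (below t' `\` below t) + mass (below t) <= t'.
  rewrite -[leRHS](coord_mass co (t := t')) ?t1 ?(le_trans t0) //.
  have mD := measurableD mt' mt.
  rewrite -mass_setU //; last by apply/seteqP; split => // x [[]].
  apply: le_mass => //; first exact: measurableU.
  by move=> x [[]|/(below_sub tt')].
rewrite (coord_mass co (t := t)) ?t0 ?(le_trans tt') //.
have -> : below t' `\` below t = below t `+` below t'.
  rewrite /setY (_ : below t `\` below t' = set0) ?set0U //.
  by apply/seteqP; split => // x [/(below_sub tt')].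
by rewrite -/(dist _ _); lra.
Qed.

Lemma approximated_below t : approximated (below t).
Proof.
have app01 u : 0 <= u -> u < 1 -> approximated (below u).
  move=> u0 u1; apply: approximated_limit (measurable_below u) _ => e e0.
  have [|j /andP[uj]] := @rat_enum_between u (Num.min 1 (u + e)).
    by rewrite lt_min u1 ltrDl.
  rewrite lt_min => /andP[j1 je]; exists (F j); split.
  - exact: measurable_below.
  - by apply: approximated_rat; rewrite (ltW j1) (le_trans u0) // ltW.
  - by apply: le_lt_trans (dist_below u0 (ltW uj) (ltW j1)) _; lra.
have [t0|t0] := ltP t 0.
  by rewrite below_lt0 // => e e0; exists 0%N => k _; rewrite !preimage_set0 distAA.
have [t1|t1] := ltP t 1; first exact: app01.
rewrite below_ge1 // => e e0; exists 0%N => k _.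
have mX := measurable_coord_dom; rewrite -[X in X < _]/(mass _) mass_negligible //.
  by apply: measurable_setY; [exact: measurable_pre_limit|exact: measurable_pre_seq].
have nS := negligible_pre preserving_limit_fun negligible_domC.
have nG := negligible_pre (pG k) negligible_domC.
apply: negligibleS (negligibleU nS nG) => x /=; tauto.
Qed.

(** [A] is approximated by a countable union of coordinate intervals, then by a finite part of
    it. *)
Lemma limit_fun_approximated A : measurable A -> approximated A.
Proof.
move=> mA; apply: approximated_limit => // e e0.
have [|l [r [lr cov sum]]] := coord_cover co mA (_ : 0 < e / 4);
  first by rewrite divr_gt0.
pose I i := below (r i) `\` below (l i).
have mI i : measurable (I i) by apply: measurableD; exact: measurable_below.
have mUI : measurable (\bigcup_i I i) by exact: bigcupT_measurable.
have appI i : approximated (I i).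
  have mr := measurable_below (r i); have ml := measurable_below (l i).
  rewrite /I setDE -[below (r i)]setCK -setCU.
  apply: approximatedC; first by apply: measurableU => //; exact: measurableC.
  apply: approximatedU => //; first exact: measurableC.
    by apply: approximatedC => //; exact: approximated_below.
  exact: approximated_below.
have massI i : mass (I i) <= r i - l i.
  apply: (uniform_increment (D := below)) => //.
  - exact: measurable_below.
  - by move=> t t'; exact: below_sub.
  - by move=> t; exact: below_lt0.
  - by move=> t t1; rewrite !below_ge1.
  - exact: (coord_mass co).
have e4 : 0 < e / 4 by rewrite divr_gt0.
have [n hn] := mass_bigcup_approx mu mI e4.
exists (\big[setU/set0]_(i < n) I i).
have mB : measurable (\big[setU/set0]_(i < n) I i) by exact: bigsetU_measurable.
split => //; first exact: approximated_bigsetU.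
have mAX : measurable (A `&` X0) by apply: measurableI => //;
  exact: measurable_coord_dom.
have AX : dist A (A `&` X0) = 0.
  apply: mass_negligible; first exact: measurable_setY.
  by apply: negligibleS negligible_domC => x /=; tauto.
rewrite (dist_eq0_trans mA mAX mB AX).
have sub : A `&` X0 `<=` \bigcup_i I i.
  move=> x [Ax X0x]; have [i /andP[lx xr]] := cov x X0x Ax; exists i => //.
  by split; [split|move=> [_ /=]; rewrite leNgt lx].
have U1 : mass (\bigcup_i I i) <= mass A + e / 4.
  by apply: mass_bigcup_le => // j; apply: le_trans (sum j); apply: ler_sum.
have dAU : dist (A `&` X0) (\bigcup_i I i) <= e / 4.
  have -> : dist (A `&` X0) (\bigcup_i I i) = mass (\bigcup_i I i `\` (A `&` X0)).
    by congr mass; rewrite /setY (_ : A `&` X0 `\` _ = set0) ?set0U //;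
      apply/seteqP; split => // x [/sub].
  have : mass (\bigcup_i I i `\` (A `&` X0)) + mass (A `&` X0) <= mass (\bigcup_i I i).
    have mD := measurableD mUI mAX.
    rewrite -mass_setU //; last by apply/seteqP; split => // x [[]].
    by apply: le_mass => //; [exact: measurableU|move=> x [[]|/sub]].
  by have := mass_dist mu mA mAX; rewrite AX; lra.
have sub' : \big[setU/set0]_(i < n) I i `<=` \bigcup_i I i.
  by rewrite -bigcup_mkord => x [i _ Ii]; exists i.
have dUB : dist (\bigcup_i I i) (\big[setU/set0]_(i < n) I i) <= e / 4.
  set V := \big[setU/set0]_(i < n) I i in hn mB sub' *.
  have -> : dist (\bigcup_i I i) V = mass (\bigcup_i I i `\` V).
    by congr mass; rewrite /setY (_ : V `\` _ = set0) ?setU0 //;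
      apply/seteqP; split => // x [/sub'].
  have : mass (\bigcup_i I i `\` V) + mass V <= mass (\bigcup_i I i).
    have mD := measurableD mUI mB.
    rewrite -mass_setU //; last by apply/seteqP; split => // x [[]].
    by apply: le_mass => //; [exact: measurableU|move=> x [[]|/sub']].
  by move: hn; lra.
have := dist_triangle mu mAX mUI mB.
by lra.
Qed.

End limit_map.

(** * Automorphisms as limits of powers *)

Section limit_aut.
Context {d} {X : measurableType d} {R : realType} (mu : probability X R).

Local Notation mass := (mass mu).
Local Notation dist := (dist mu).

Lemma dist_ae (S S' : X -> X) A : preserving mu S -> measurable_fun setT S' ->
  mu.-negligible [set x | S' x <> S x] -> measurable A ->
  dist (S' @^-1` A) (S @^-1` A) = 0.
Proof.
move=> pS mS' nN mA; apply: mass_negligible.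
  apply: measurable_setY; last exact: measurable_pre pS mA.
  by rewrite -[X in measurable X]setTI; exact: mS'.
apply: negligibleS nN => x /= h e; move: h; rewrite /setY /= e; tauto.
Qed.

Lemma dist0_mass A A' : measurable A -> measurable A' -> dist A A' = 0 -> mass
  A = mass A'.
Proof.
move=> mA mA' d0; apply/eqP; rewrite eq_le.
have := mass_dist mu mA mA'; have := mass_dist mu mA' mA.
by rewrite (distC mu A') d0 !addr0 => -> ->.
Qed.

(* Two maps inverse to each other almost everywhere are exact inverses on the
   set of points whose whole orbit avoids the exceptional set. *)
Lemma aut_of_inverse (S S' : X -> X) : preserving mu S -> preserving mu S' ->
  mu.-negligible [set x | S' (S x) <> x] -> mu.-negligible [set x | S (S' x) <> x] ->
  exists U : mp_aut mu, mu.-negligible [set x | U x <> S x].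
Proof.
move=> pS pS' n1 n2; have [Z [mZ Z0 NZ]] := negligibleU n1 n2.
have nZ : mu.-negligible Z by apply/negligibleP.
have pit n := preserving_iter n pS; have pit' n := preserving_iter n pS'.
pose D := \bigcap_n (iter n S @^-1` (~` Z) `&` iter n S' @^-1` (~` Z)).
have mD : measurable D.
  apply: bigcapT_measurable => n; apply: measurableI.
    exact: measurable_pre (pit n) (measurableC mZ).
  exact: measurable_pre (pit' n) (measurableC mZ).
have nD : mu.-negligible (~` D).
  apply: (@negligibleS _ _ _ _ (\bigcup_n (iter n S @^-1` Z `|` iter n S' @^-1` Z))).
    move=> x nDx; apply: contrapT => nx; apply: nDx => n _; split => /= zx;
      apply: nx; exists n => //; first by left.
    by right.
  apply: negligible_bigcup => n; apply: negligibleU.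
    exact: negligible_pre (pit n) nZ.
  exact: negligible_pre (pit' n) nZ.
have inv x : D x -> S' (S x) = x /\ S (S' x) = x.
  move=> /(_ 0%N Logic.I)[/= nZx _].
  by split; apply: contrapT => ne; apply: nZx; apply: NZ; [left|right].
have DS x : D x -> D (S x).
  move=> Dx n _; split => /=.
    by have := Dx n.+1 Logic.I; rewrite /= -iterSr => -[].
  case: n => [|n]; first by have := Dx 1%N Logic.I => -[].
  rewrite iterSr (inv _ Dx).1; by have := Dx n Logic.I => -[].
have DS' x : D x -> D (S' x).
  move=> Dx n _; split => /=; last first.
    by have := Dx n.+1 Logic.I; rewrite /= -iterSr => -[].
  case: n => [|n]; first by have := Dx 1%N Logic.I => -[].
  rewrite iterSr (inv _ Dx).2; by have := Dx n Logic.I => -[].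
pose U x := if pselect (D x) then S x else x.
pose U' x := if pselect (D x) then S' x else x.
have UK : cancel U U'.
  move=> x; rewrite /U; case: pselect => Dx; rewrite /U'; case: pselect => // Dx'.
    exact: (inv _ Dx).1.
  by case: Dx'; exact: DS.
have UK' : cancel U' U.
  move=> x; rewrite /U'; case: pselect => Dx; rewrite /U; case: pselect => // Dx'.
    exact: (inv _ Dx).2.
  by case: Dx'; exact: DS'.
have meas V : preserving mu V ->
    measurable_fun setT (fun x => if pselect (D x) then V x else x).
  move=> pV _ A mA; rewrite setTI.
  rewrite (_ : _ @^-1` A = (D `&` V @^-1` A) `|` (~` D `&` A)).
    apply: measurableU; apply: measurableI => //; last exact: measurableC.
    exact: measurable_pre pV mA.
  apply/seteqP; split => x; rewrite /preimage /mkset; case: pselect => Dx.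
  - by move=> Ax; left.
  - by move=> Ax; right.
  - by case=> -[].
  - by case=> -[].
have mU := meas _ pS; have mU' := meas _ pS'.
have nU : mu.-negligible [set x | U x <> S x].
  by apply: negligibleS nD => x /=; rewrite /U; case: pselect.
have pU A : measurable A -> mu (U @^-1` A) = mu A.
  move=> mA; have mUA : measurable (U @^-1` A).
    by rewrite -[X in measurable X]setTI; exact: mU.
  rewrite (massE mu mUA) (massE mu mA); congr EFin.
  rewrite -(mass_pre pS mA); apply: dist0_mass => //; first exact: measurable_pre pS mA.
  exact: dist_ae pS mU nU mA.
by exists (MpAut UK UK' mU mU' pU).
Qed.

Variables (X0 : set X) (psi : X -> R).
Hypothesis co : coordinate mu X0 psi.
Hypothesis cmu : measure_is_complete mu.
Variable T : mp_aut mu.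
Local Notation tp := (aut_pow T).
Local Notation F := (fun j => below X0 psi (rat_enum j)).

Lemma dist_pow_shift w z z' C : measurable C ->
  dist (tp (z + w) @^-1` C) (tp (z' + w) @^-1` C) = dist (tp z @^-1` C) (tp z' @^-1` C).
Proof.
move=> mC; have m z1 := measurable_pre (preserving_pow T z1) mC.
rewrite -(dist_pre (preserving_pow T w) (m z) (m z')).
have e z1 : tp (z1 + w) @^-1` C = tp w @^-1` (tp z1 @^-1` C).
  by apply/seteqP; split => x /=; rewrite aut_powD.
by rewrite !e.
Qed.

(** Translating by [s k + s k.+1] turns the estimates for [s] into the same ones for [- s]. Both
    sequences of powers therefore have limits, and these are mutually inverse almost everywhere. *)
Lemma limit_aut (s : nat -> int) :
  (forall k j, (j <= k)%N ->
    dist (tp (s k.+1) @^-1` F j) (tp (s k) @^-1` F j) <= 2^-1 ^+ k) ->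
  exists2 U : mp_aut mu, commuting T U & forall A, measurable A -> forall e, 0 < e ->
    exists K, forall k, (K <= k)%N -> dist (U @^-1` A) (tp (s k) @^-1` A) < e.
Proof.
move=> sd; have pz z := preserving_pow T z.
have mF j : measurable (F j) by exact: (measurable_below co).
have sd' k j : (j <= k)%N ->
    dist (tp (- s k.+1) @^-1` F j) (tp (- s k) @^-1` F j) <= 2^-1 ^+ k.
  move=> jk; rewrite -(dist_pow_shift (s k + s k.+1)) //.
  rewrite (_ : - s k.+1 + _ = s k); last by lia.
  rewrite (_ : - s k + _ = s k.+1); last by lia.
  by rewrite distC; exact: sd.
have [S pS Sapp] : exists2 S, preserving mu S & forall A,
  measurable A -> forall e, 0 < e ->
    exists K, forall k, (K <= k)%N -> dist (S @^-1` A) (tp (s k) @^-1` A) < e.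
  exists (limit_fun X0 psi (fun k => tp (s k))).
    by apply: (preserving_limit_fun co) => // k; exact: pz.
  by move=> A mA; apply: (limit_fun_approximated co) => // k; exact: pz.
have [S' pS' Sapp'] : exists2 S, preserving mu S & forall A,
  measurable A -> forall e, 0 < e ->
    exists K, forall k, (K <= k)%N -> dist (S @^-1` A) (tp (- s k) @^-1` A) < e.
  exists (limit_fun X0 psi (fun k => tp (- s k))).
    by apply: (preserving_limit_fun co) => // k; exact: pz.
  by move=> A mA; apply: (limit_fun_approximated co) => // k; exact: pz.
have inv (V V' : X -> X) (t t' : nat -> int) : preserving mu V -> preserving mu V' ->
    (forall k, t k + t' k = 0) ->
    (forall A, measurable A -> forall e, 0 < e ->
      exists K, forall k, (K <= k)%N -> dist (V @^-1` A) (tp (t k) @^-1` A) < e) ->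
    (forall A, measurable A -> forall e, 0 < e ->
      exists K, forall k, (K <= k)%N -> dist (V' @^-1` A) (tp (t' k) @^-1` A) < e) ->
    mu.-negligible [set x | V' (V x) <> x].
  move=> pV pV' tt Vapp Vapp'.
  apply: (ae_eq_of_dist co (preserving_comp pV pV') (preserving_id mu)) => A mA.
  apply/eqP; rewrite eq_le dist_ge0 andbT; apply/ler_addgt0Pr => e e0; rewrite add0r.
  have mVA := measurable_pre pV' mA.
  have e2 : 0 < e / 2 by rewrite divr_gt0.
  have [K HK] := Vapp _ mVA _ e2; have [K' HK'] := Vapp' _ mA _ e2.
  have := HK _ (leq_maxl K K'); have := HK' _ (leq_maxr K K'); set k := maxn K K'.
  have mtA z := measurable_pre (pz z) mA.
  rewrite -(dist_pre (pz (t k)) mVA (mtA _)).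
  have -> : tp (t k) @^-1` (tp (t' k) @^-1` A) = A.
    by apply/seteqP; split => x /=; rewrite -aut_powD addrC tt.
  have := dist_triangle mu (measurable_pre pV mVA) (measurable_pre (pz (t k)) mVA) mA.
  rewrite comp_preimage preimage_id.
  by lra.
have n1 := inv S S' s (fun k => - s k) pS pS' (fun k => subrr _) Sapp Sapp'.
have n2 := inv S' S (fun k => - s k) s pS' pS (fun k => addNr _) Sapp' Sapp.
have cS : commuting T S.
  have pT := preserving_fun T.
  apply: (ae_eq_of_dist co (preserving_comp pT pS) (preserving_comp pS pT)) => A mA.
  rewrite -[X in dist X _]/(T @^-1` (S @^-1` A)) -[X in dist _ X]/(S @^-1` (T @^-1` A)).
  apply/eqP; rewrite eq_le dist_ge0 andbT; apply/ler_addgt0Pr => e e0; rewrite add0r.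
  have mTA := measurable_pre pT mA; have mSA := measurable_pre pS mA.
  have e2 : 0 < e / 2 by rewrite divr_gt0.
  have [K HK] := Sapp _ mTA _ e2; have [K' HK'] := Sapp _ mA _ e2.
  have := HK _ (leq_maxl K K'); have := HK' _ (leq_maxr K K'); set k := maxn K K'.
  have mtA := measurable_pre (pz (s k)) mA.
  rewrite -(dist_pre pT mSA mtA).
  have -> : T @^-1` (tp (s k) @^-1` A) = tp (s k) @^-1` (T @^-1` A).
    by apply/seteqP; split => x /=; rewrite -aut_powS aut_powD.
  have := dist_triangle mu (measurable_pre pT mSA) (measurable_pre (pz (s k))
    mTA) (measurable_pre pS mTA).
  rewrite (distC mu (tp (s k) @^-1` _) (S @^-1` _)).
  by lra.
have [U nU] := aut_of_inverse pS pS' n1 n2.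
have pU := preserving_fun U.
exists U.
  apply: negligibleS (negligibleU (negligibleU nU (negligible_pre
    (preserving_fun T) nU)) cS).
  move=> x /= ne; apply: contrapT => h; apply: ne.
  have -> : U (T x) = S (T x) by apply: contrapT => ne; apply: h; left; right.
  have -> : U x = S x by apply: contrapT => ne; apply: h; left; left.
  by apply: contrapT => ne; apply: h; right.
move=> A mA e e0; have [K HK] := Sapp _ mA _ e0; exists K => k /HK; apply: le_lt_trans.
have mUA := measurable_pre pU mA; have mSA := measurable_pre pS mA.
rewrite (dist_eq0_trans mUA mSA (measurable_pre (pz (s k)) mA)) //.
exact: dist_ae pS (measurable_aut_fun U) nU mA.
Qed.

End limit_aut.

(** * Long windows of constant spacers *)

Section rigid.
Context {d} {X : measurableType d} {R : realType} (mu : probability X R).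
Variables (T : mp_aut mu) (q : nat -> nat) (a : nat -> nat -> nat).

Local Notation tp := (aut_pow T).
Local Notation mass := (mass mu).
Local Notation dist := (dist mu).
Local Notation h := (height q a).

Variable B : nat -> set X.
Hypothesis HB : tower_bases T q a B.
Hypothesis q_gt1 : forall n, (1 < q n)%N.

Lemma spacer_in n l r : (0 < r < cuts q n l)%N -> exists s i,
  [/\ (n <= s < n + l)%N, (0 < i < q s)%N & spacer q a n r = a s i].
Proof.
elim: l n r => [|l IH] n r; first by rewrite cuts0; lia.
rewrite cutsSl => /andP[r0 rc]; rewrite spacerE //; case: ifPn => dv.
  have [|s [i [h1 h2 h3]]] := IH n.+1 (r %/ q n)%N.
    by rewrite divq_gt0 //= ltn_divLR ?(ltnW (q_gt1 n)) // mulnC.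
  by exists s, i; split => //; clear -h1; lia.
exists n, (r %% q n)%N; split => //; first by clear; lia.
by rewrite lt0n dv ltn_mod (ltnW (q_gt1 n)).
Qed.

Lemma constant_start N k : ~ varying_spacers q a N k ->
  exists c, forall r, (r < cuts q N k)%N -> start q a N r = (r * (h N + c))%N.
Proof.
move=> const; exists (spacer q a N 1).
have same r : (0 < r < cuts q N k)%N -> spacer q a N r = spacer q a N 1.
  move=> rc; have rc1 : (0 < 1 < cuts q N k)%N by lia.
  have [s [i [h1 h2 ->]]] := spacer_in rc; have [s' [i' [h1' h2' ->]]] := spacer_in rc1.
  by apply: contrapT => ne; apply: const; exists s, s', i, i'.
elim=> [|r IH] rc; first by rewrite start0.
by rewrite startS (IH (ltnW rc)) (same r.+1) // mulSn; lia.
Qed.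

Lemma cuts_le_height n l : (cuts q n l <= h (n + l))%N.
Proof.
have c0 := cuts_gt0 q_gt1 n l.
have := start_block a q_gt1 (_ : ((cuts q n l).-1 < cuts q n l)%N).
rewrite prednK // => /(_ (leqnn _)); apply: leq_trans.
have := leq_start_id a q_gt1 n (cuts q n l).-1; have := height_gt0 a q_gt1 n; lia.
Qed.

(** [B N] is an arithmetic progression, with step [c], of translates of [B (N + k)]; moving it by
    one step changes only its two ends. Descending to stage [n] costs a factor at most [h N], and
    [h N / h (N + k)] is at most [2^-1 ^+ k]. *)
Lemma dist_return n N k c : (n <= N)%N ->
  (forall r, (r < cuts q N k)%N -> start q a N r = (r * c)%N) ->
  dist (tp c @^-1` B n) (B n) <= 2 * 2^-1 ^+ k.
Proof.
move=> nN hc; have mB m := base_measurable HB m.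
have pc := preserving_pow T c; have mtB z m := measurable_pre (preserving_pow T
  z) (mB m).
have Q0 := cuts_gt0 q_gt1 N k.
have dN : dist (tp c @^-1` B N) (B N) <= 2 * mass (B (N + k)%N).
  pose z : int := - ((cuts q N k).-1 * c)%N%:Z.
  apply: (@le_trans _ _ (mass (tp c @^-1` B (N + k)%N `|` tp z @^-1` B (N + k)%N))).
    apply: le_mass; [exact: measurable_setY|exact: measurableU|].
    move=> x [[/= Bc nB]|[/= Bx nBc]].
      move: Bc => /(base_cuts HB q_gt1 N k)[[|r] rc]; rewrite hc // => Br.
        by left; rewrite mul0n oppr0 in Br.
      exfalso; apply: nB; apply/(base_cuts HB q_gt1 N k); exists r; first lia.
      rewrite hc; last by lia.
      by move: Br; rewrite -aut_powD; congr (B _ (tp _ _)); lia.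
    move: Bx => /(base_cuts HB q_gt1 N k)[r rc]; rewrite hc // => Br.
    have [rl|rl] := ltnP r.+1 (cuts q N k); last first.
      by right; rewrite /= /z (_ : (cuts q N k).-1 = r) //; lia.
    exfalso; apply: nBc; apply/(base_cuts HB q_gt1 N k); exists r.+1 => //.
    rewrite hc // -aut_powD; move: Br; congr (B _ (tp _ _)).
    by rewrite mulSn; lia.
  apply: le_trans (mass_setU_le mu (mtB _ _) (mtB _ _)) _.
  by rewrite !mass_pre // ?mulr_natl ?mulr2n //; exact: preserving_pow.
have h0 m : 0 < (h m)%:R :> R by rewrite ltr0n height_gt0.
have := dist_base_le HB q_gt1 n (N - n) pc (commuting_pow T c) (preserving_id mu)
  (commuting_pow T 0).
rewrite subnKC // => /le_trans; apply.
apply: (@le_trans _ _ ((h N)%:R * (2 * (h (N + k))%:R^-1))).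
  apply: ler_pM; rewrite ?ler0n ?dist_ge0 //.
    by rewrite ler_nat; have := cuts_le_height n (N - n); rewrite subnKC.
  apply: le_trans dN _; rewrite ler_wpM2l //; exact: (mass_base_le HB q_gt1).
rewrite mulrCA ler_wpM2l // ler_pdivrMr // exprVn.
rewrite mulrC ler_pdivlMr ?exprn_gt0 // -natrX -natrM ler_nat mulnC.
exact: height_ge.
Qed.

Hypothesis constant : forall k, exists N, ~ varying_spacers q a N k.

Lemma rigid : exists rho : nat -> nat, (forall k, 0 < rho k)%N /\
  forall A e, measurable A -> 0 < e -> exists K, forall k, (K <= k)%N ->
    dist (tp (rho k) @^-1` A) A < e.
Proof.
have /choice[rho Hrho] : forall k, exists c, (0 < c)%N /\
    forall n, (n <= k)%N -> dist (tp c%:Z @^-1` B n) (B n) <= 2 * 2^-1 ^+ k.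
  (* A constant window of length [k + k] contains one of length [k] starting at [N + k], hence after
     every stage [n <= k]. *)
  move=> k; have [N HN] := constant (k + k).
  have [|c Hc] := @constant_start (N + k) k.
    move=> [s [s' [i [i' [h1 h2 h3 h4 h5]]]]]; apply: HN; exists s, s', i, i'.
    by split => //; clear -h1 h2; lia.
  exists (h (N + k) + c)%N; split; first by rewrite addn_gt0 height_gt0.
  by move=> n nk; apply: dist_return Hc; lia.
exists rho; split => [k|A e mA e0]; first by have [] := Hrho k.
have mB m := base_measurable HB m.
have e4 : 0 < e / 4 by rewrite divr_gt0.
have [s sh sd] := base_dense HB mA e4.
pose M := \max_(p <- s) p.1.
have [K HK] := geometric_small (divr_gt0 e4 (ltr0Sn R (size s))).
exists (maxn K M) => k Kk; have p1 := preserving_pow T (rho k).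
set V := \big[setU/set0]_(p <- s) _ in sd.
have mV : measurable V by apply: bigsetU_measurable => p _; exact: (measurable_lev HB).
have dV : dist (tp (rho k) @^-1` V) V <= e / 4.
  rewrite -[X in dist _ X](_ : id @^-1` V = V) // /V !preimage_bigsetU.
  apply: le_trans (dist_bigsetU mu _ _ _) _ => [p|p|].
  - exact: measurable_pre p1 (measurable_lev HB _ _).
  - exact: (measurable_lev HB).
  - apply: (@le_trans _ _ (\sum_(p <- s) (e / 4 / (size s).+1%:R))).
      rewrite big_seq [leRHS]big_seq; apply: ler_sum => p ps.
      rewrite (dist_pre_pow _ p1 (commuting_pow T _) (preserving_id mu)
        (commuting_pow T 0)) //.
      apply: le_trans (ltW (HK k _)); last by apply: leq_trans Kk; exact: leq_maxl.
      apply: (Hrho k).2; apply: leq_trans (leq_trans (leq_maxr K M) Kk).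
      exact: leq_bigmax_seq.
    rewrite big_const_seq count_predT iter_addr addr0.
    by rewrite -[X in X <= _]mulr_natr mulrAC ler_pdivrMr // ler_wpM2l ?(ltW
      e4) // ler_nat.
have mtA := measurable_pre p1 mA; have mtV := measurable_pre p1 mV.
have := dist_triangle mu mtA mtV mA; have := dist_triangle mu mtV mV mA.
rewrite (dist_pre p1 mA mV) (distC mu V A).
by move: sd; rewrite -/V; lra.
Qed.

Lemma rigid_family m (E : nat -> set X) (e : nat -> R) : (forall i, measurable (E i)) ->
  (forall i, 0 < e i) -> exists2 c, (0 < c)%N &
    forall i, (i <= m)%N -> dist (tp c%:Z @^-1` E i) (E i) < e i.
Proof.
move=> mE e0; have [rho [rho0 Hrho]] := rigid.
have /choice[K HK] := fun i => Hrho _ _ (mE i) (e0 i).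
exists (rho (\max_(i < m.+1) K i)) => // i im; apply: HK.
exact: (leq_bigmax (Ordinal (im : (i < m.+1)%N))).
Qed.

Variables (X0 : set X) (psi : X -> R).
Hypothesis co : coordinate mu X0 psi.
Hypothesis cmu : measure_is_complete mu.
Local Notation F := (fun j => below X0 psi (rat_enum j)).

(* The sets [T^-s (B g')] and [T^-(s + c) (B g')] are disjoint, so at least one
   of [s] and [s + c] keeps the limit away from [T^z]. *)
Lemma diagonal_step (k : nat) (z s : int) (g : nat) : exists (s' : int) (g' : nat),
  [/\ (g <= g')%N,
    forall j, (j <= k)%N -> dist (tp s' @^-1` F j) (tp s @^-1` F j) <= 2^-1 ^+ k,
    forall j, (j <= g)%N ->
      dist (tp s' @^-1` B j) (tp s @^-1` B j) <= 2^-1 ^+ k / 8 * mass (B j) &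
    mass (B g') <= dist (tp s' @^-1` B g') (tp z @^-1` B g')].
Proof.
have mB j := base_measurable HB j; have mF j := measurable_below co (rat_enum j).
have mtB w j := measurable_pre (preserving_pow T w) (mB j).
(* The sets governing convergence and those governing distance from powers are interleaved, so that
   one exponent [c] serves both. *)
pose E i := if odd i then B i./2 else F i./2.
pose e i : R := if odd i then 2^-1 ^+ k / 8 * mass (B i./2) else 2^-1 ^+ k.
have [|i|c c0 Hc] := @rigid_family (k + g).*2.+1 E e.
- by move=> i; rewrite /E; case: ifP.
- have k0 : 0 < 2^-1 ^+ k :> R by rewrite exprn_gt0.
  by rewrite /e; case: ifP => // _;
    rewrite mulr_gt0 ?divr_gt0 // (mass_base_gt0 HB q_gt1).
have HF j : (j <= k)%N -> dist (tp c%:Z @^-1` F j) (F j) <= 2^-1 ^+ k.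
  move=> jk; have := Hc j.*2; rewrite /E /e odd_double doubleK => /(_ _)/ltW; apply.
  by rewrite -leq_double in jk; lia.
have HBj j : (j <= g)%N -> dist (tp c%:Z @^-1` B j) (B j) <= 2^-1 ^+ k / 8 * mass (B j).
  move=> jg; have := Hc j.*2.+1; rewrite /E /e /= odd_double /= uphalf_double
    => /(_ _)/ltW; apply.
  by rewrite ltnS leq_double; lia.
(* [g' >= c] makes the tower taller than [c], so [T^c] moves [B g'] off itself. *)
pose g' := maxn g c; have gg' : (g <= g')%N by exact: leq_maxl.
have shift C : measurable C -> dist (tp (s + c) @^-1` C) (tp s @^-1` C) =
    dist (tp c @^-1` C) C.
  move=> mC; rewrite -[in X in dist _ X](add0r s) (addrC s) dist_pow_shift //.
have far : 2 * mass (B g') = dist (tp (s + c) @^-1` B g') (tp s @^-1` B g').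
  rewrite shift // dist_disjoint //.
    by rewrite mass_pre ?mulr_natl ?mulr2n //; exact: preserving_pow.
  apply/seteqP; split => // x [/= Bc Bx]; apply: (base_disjoint HB _ Bx Bc).
  rewrite c0 /=; apply: leq_ltn_trans (ltn_height a q_gt1 g'); exact: leq_maxr.
have [le|gt] := leP (mass (B g')) (dist (tp s @^-1` B g') (tp z @^-1` B g')).
  exists s, g'; split => // j jk; rewrite distAA.
    by rewrite exprn_ge0.
  by rewrite mulr_ge0 ?mass_ge0 // divr_ge0 // exprn_ge0.
exists (s + c), g'; split => //.
- by move=> j jk; rewrite shift //; exact: HF.
- by move=> j jk; rewrite shift //; exact: HBj.
- have := dist_triangle mu (mtB (s + c) g') (mtB z g') (mtB s g').
  by rewrite -far (distC mu _ (tp s @^-1` _)); lra.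
Qed.

Definition int_enum (j : nat) : int := odflt 0 (unpickle j : option int).

(** Step [k] keeps the sequence at distance at least [mass (B G)] from the [k]-th power [T^z] on its
    test base [B G]. The factor [1 / 8] keeps all later drift on that base within a quarter of its
    mass; a further quarter for the passage to the limit still leaves [U] away from [T^z]. *)
Lemma nontrivial_centralizer : exists2 U : mp_aut mu, commuting T U &
  forall z, ~ mu.-negligible [set x | U x <> tp z x].
Proof.
have mB j := base_measurable HB j.
have mtB w j := measurable_pre (preserving_pow T w) (mB j).
have /choice[next Hnext] : forall p : nat * (int * nat), exists p' : int * nat,
  [/\ (p.2.2 <= p'.2)%N,
    forall j, (j <= p.1)%N -> dist (tp p'.1 @^-1` F j) (tp p.2.1 @^-1` F j) <=
      2^-1 ^+ p.1,
    forall j, (j <= p.2.2)%N ->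
      dist (tp p'.1 @^-1` B j) (tp p.2.1 @^-1` B j) <= 2^-1 ^+ p.1 / 8 * mass (B j) &
    mass (B p'.2) <= dist (tp p'.1 @^-1` B p'.2) (tp (int_enum p.1) @^-1` B p'.2)].
  move=> [k [s g]]; have [s' [g' H']] := diagonal_step k (int_enum k) s g.
  by exists (s', g').
pose st := fix st k := if k is k'.+1 then next (k', st k') else (0, 0%N).
pose s k := (st k).1; pose g k := (st k).2.
have gS k : (g k <= g k.+1)%N by have [] := Hnext (k, st k).
have sF k j : (j <= k)%N -> dist (tp (s k.+1) @^-1` F j) (tp (s k) @^-1` F j)
  <= 2^-1 ^+ k.
  by have [_ + _ _] := Hnext (k, st k); apply.
have sB k j : (j <= g k)%N ->
    dist (tp (s k.+1) @^-1` B j) (tp (s k) @^-1` B j) <= 2^-1 ^+ k / 8 * mass (B j).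
  by have [_ _ + _] := Hnext (k, st k); apply.
have sz k : mass (B (g k.+1)) <=
    dist (tp (s k.+1) @^-1` B (g k.+1)) (tp (int_enum k) @^-1` B (g k.+1)).
  by have [_ _ _ +] := Hnext (k, st k).
have [U cU appU] := limit_aut co cmu sF.
exists U => // z nz; have pU := preserving_fun U.
pose k := pickle z; have zk : int_enum k = z by rewrite /int_enum pickleK.
set G := g k.+1; have B0 := mass_base_gt0 HB q_gt1 G.
have gmono i : (G <= g (k.+1 + i))%N.
  elim: i => [|i IH]; first by rewrite addn0.
  by rewrite addnS; apply: leq_trans IH (gS _).
have tail i : dist (tp (s (k.+1 + i)%N) @^-1` B G) (tp (s k.+1) @^-1` B G) <=
    (1 - 2^-1 ^+ i) / 4 * mass (B G).
  elim: i => [|i IH]; first by rewrite addn0 distAA expr0 subrr !mul0r.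
  have := sB _ _ (gmono i); rewrite -addnS => step.
  have := dist_triangle mu (mtB (s (k.+1 + i.+1)%N) G) (mtB (s (k.+1 + i)%N) G)
    (mtB (s k.+1) G).
  have : 2^-1 ^+ (k.+1 + i) / 8 * mass (B G) <= 2^-1 ^+ i / 8 * mass (B G).
    rewrite ler_wpM2r ?mass_ge0 // ler_wpM2r // exprD ler_piMl ?exprn_ge0 //.
    by rewrite exprn_ile1 // invf_le1 ?ltr0n // ler1n.
  by move: step IH; rewrite exprS; lra.
have [K HK] := appU _ (mB G) _ (divr_gt0 B0 (ltr0Sn R 3)).
pose i := (k.+1 + K)%N.
have := HK i (leq_addl _ _); have := tail K; rewrite -/i.
have mUB := measurable_pre pU (mB G).
have Uz : dist (U @^-1` B G) (tp z @^-1` B G) = 0.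
  by apply: (dist_ae (preserving_pow T z) (measurable_aut_fun U) nz).
have := sz k; rewrite zk -/G.
have := dist_triangle mu (mtB (s k.+1) G) (mtB (s i) G) (mtB z G).
have := dist_triangle mu (mtB (s i) G) mUB (mtB z G).
rewrite Uz (distC mu (tp (s i) @^-1` _) (U @^-1` _)) (distC mu (tp (s k.+1)
  @^-1` _) (tp (s i) @^-1` _)).
have : 0 <= 2^-1 ^+ K * mass (B G) by rewrite mulr_ge0 ?mass_ge0 // exprn_ge0.
by lra.
Qed.

End rigid.

(** * Towers on the space itself *)

Section unit_interval_model.
Context {R : realType}.
Notation nu := (unit_lebesgue R).
Implicit Types V : set (unit_interval R).

(** The completed measure is by construction the outer measure, an infimum over countable covers by
    half-open intervals. *)
Lemma unit_lebesgue_cover V e : measurable V -> 0 < e ->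
  exists l r : nat -> R, [/\ forall i, l i <= r i,
    forall y, V y -> exists i, l i < val y <= r i &
    forall n, \sum_(i < n) (r i - l i) <= mass nu V + e].
Proof.
move=> mV e0.
have : @completed_lebesgue_measure R (emb V) \is a fin_num.
  by rewrite -/(nu V) (massE nu mV).
move/lb_ereal_inf_adherent => /(_ _ e0)[_ [A covA <-]] ltA.
have /choice[lr Hlr] : forall k, exists p : R * R,
    [/\ p.1 <= p.2, A k `<=` `]p.1, p.2]%classic &
      wlength (@idfun R) (A k) = (p.2 - p.1)%:E].
  move=> k; have /ocitvP[->|[p lt ->]] := cover_measurable covA k.
    by exists (0, 0); rewrite wlength0 subrr; split => //= x.
  by exists p; split => //; [exact: ltW|apply: wlength_itv_bnd; exact: ltW].
exists (fun k => (lr k).1), (fun k => (lr k).2); split.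
- by move=> i; have [] := Hlr i.
- move=> y Vy; have [|k _ Ak] := cover_subset covA (_ : emb V (val y)).
    by exists y.
  exists k; have [_ + _] := Hlr k => /(_ _ Ak) /=; by rewrite in_itv.
- move=> n; rewrite -lee_fin; apply: ltW; rewrite EFinD -massE //;
  apply: le_lt_trans _ ltA.
  rewrite -sumEFin.
  have -> : (\sum_(i < n) ((lr i).2 - (lr i).1)%:E = \sum_(0 <= i < n) wlength
    (@idfun R) (A i))%E.
    by rewrite big_mkord; apply: eq_bigr => i _; have [_ _ ->] := Hlr i.
  apply: nneseries_lim_ge => i _ _; have [le _ ->] := Hlr i.
  by rewrite lee_fin subr_ge0.
Qed.

Lemma measurable_unit_le t : measurable [set y : unit_interval R | val y <= t].
Proof.
rewrite /measurable /= /lebesgue_measurable.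
rewrite (_ : emb _ = `[0, 1]%classic `&` `]-oo, t]%classic).
  by apply: sub_caratheodory; apply: measurableI; exact: measurable_itv.
apply/seteqP; split => x.
  move=> [[y y01] /= yt <-]; rewrite !in_itv /=; split => //.
by rewrite /= !in_itv /= => -[x01 xt]; exists (exist _ x x01).
Qed.

Lemma mass_unit_le t : 0 <= t <= 1 -> mass nu [set y :
  unit_interval R | val y <= t] = t.
Proof.
move=> /andP[t0 t1].
have emb_t : emb [set y : unit_interval R | val y <= t] = `[0, t]%classic.
  apply/seteqP; split => x.
    move=> [[y y01] /= yt <-]; rewrite in_itv /= yt andbT; by case/andP: y01.
  rewrite /= in_itv /= => /andP[x0 xt].
  have x01 : 0 <= x <= 1 by rewrite x0 (le_trans xt).
  by exists (exist _ x x01).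
transitivity (fine (@lebesgue_measure R `[0, t]%classic)); first by rewrite -emb_t.
rewrite lebesgue_measure_itv /= lte_fin; case: ltgtP t0 => //= _ _.
by rewrite subr0.
Qed.

Section towers_bases.
Variables (T : mp_aut nu) (q : nat -> nat) (a : nat -> nat -> nat).
Variables (B : nat -> set (unit_interval R)) (B' : nat -> nat -> set (unit_interval R))
  (C : nat -> nat -> nat -> set (unit_interval R)).
Local Notation tp := (aut_pow T).

Lemma iter_image k (D : set (unit_interval R)) : iter k T @` D = tp (- k%:Z) @^-1` D.
Proof.
apply/seteqP; split => x.
  by move=> [y Dy <-]; rewrite /= -[iter k T y]/(tp k%:Z y) aut_powK.
by move=> Dx; exists (tp (- k%:Z) x) => //; exact: (aut_powNK T k%:Z x).
Qed.

Lemma tower_bases_towers : (forall n, (1 < q n)%N) -> towers T q a B B' C ->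
  tower_bases T q a B.
Proof.
move=> q_gt1 tow.
(* Passing from one piece to the next crosses one block and its [a n i.+1] spacers; pieces are
   numbered from 1 and blocks from 0. *)
have sub n i : (i < q n)%N -> B' n i.+1 = tp (- (start q a n i)%:Z) @^-1` B n.+1.
  elim: i => [|i IH] iq; first by rewrite start0 oppr0 -(towers_base tow).
  have iq' : (0 < i.+1 < q n)%N by [].
  have spE : spacer q a n i.+1 = a n i.+1.
    by rewrite spacerE // gtnNdvd // modn_small.
  have -> : B' n i.+2 = iter (height q a n + a n i.+1) T @` B' n i.+1.
    have [a0|a0] := eqVneq (a n i.+1) 0%N.
      by rewrite a0 addn0 (towers_nospacer tow).
    have spC j : (j < a n i.+1)%N -> C n i.+1 j.+1 = iter (height q a n + j) T
      @` B' n i.+1.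
      elim: j => [|j IHj] ja; first by rewrite addn0 (towers_spacer tow) //; apply/eqP.
      by rewrite -(towers_next tow) // (IHj (ltnW ja)) addnS image_comp.
    rewrite -(towers_last tow) //; last by apply/eqP.
    rewrite -(prednK (_ : 0 < a n i.+1)%N) ?lt0n // spC ?prednK ?lt0n //.
    by rewrite -{2}(prednK (_ : 0 < a n i.+1)%N) ?lt0n // addnS image_comp.
  rewrite iter_image (IH (ltnW iq)); apply/seteqP; split => x /=;
    by rewrite -aut_powD -opprD -PoszD startS spE addnA.
split.
- exact: (towers_measB tow).
- move=> n x; have [cov _ _] := towers_partition tow n.
  rewrite -cov; split.
    move=> [[|i] /= iq Bi]; first by lia.
    by exists i => //; move: Bi; rewrite sub.
  by move=> [r rq Br]; exists r.+1 => //=; rewrite sub.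
- move=> n k x kh Bx Bk.
  have tI := @towers_disjoint _ _ _ _ _ _ _ _ _ _ tow n.
  have : k = 0%N.
    apply: tI => //=; [lia|apply: height_gt0 => //|].
    exists (tp k%:Z x); split; last by exists (tp k%:Z x).
    by exists x.
  by lia.
- move=> D e mD e0; have [s sh sd] := towers_dense tow mD e0.
  exists s => //; rewrite -lte_fin -massE; last first.
    apply: measurable_setY => //; apply: bigsetU_measurable => p _.
    exact: measurable_pre (preserving_pow T _) (towers_measB tow _).
  by move: sd; under eq_bigr do rewrite /level iter_image.
Qed.

End towers_bases.

End unit_interval_model.

(** * Pullback along the isomorphism with the unit interval *)

Section pullback.
Context {d} {X : measurableType d} {R : realType} (mu : probability X R).
Notation nu := (unit_lebesgue R).
Variables (T : mp_aut mu) (T0 : mp_aut nu).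
Variables (X0 : set X) (Y0 : set (unit_interval R)) (phi : X -> unit_interval R).
Hypothesis iso : iso_mod0 mu nu X0 Y0 phi.
Hypothesis TX0 : T @` X0 = X0.
Hypothesis phiT : forall x, X0 x -> phi (T x) = T0 (phi x).

Let mX0 : measurable X0. Proof. by have [[]] := iso. Qed.
Let mY0 : measurable Y0. Proof. by have [_ []] := iso. Qed.

Lemma negligible_isoC : mu.-negligible (~` X0).
Proof. by have [[_ e] _ _ _ _ _] := iso; apply/negligibleP => //;
  exact: measurableC. Qed.

Lemma iso_im x : X0 x -> Y0 (phi x).
Proof. by have [_ _ [fX _ _] _ _ _] := iso; exact: fX. Qed.

Lemma measurable_pull V : measurable V -> measurable (X0 `&` phi @^-1` V).
Proof.
move=> mV; have [_ _ _ _ pre _] := iso.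
rewrite (_ : _ `&` _ = X0 `&` phi @^-1` (V `&` Y0)).
  by apply: pre => [|x []//]; exact: measurableI.
by apply/seteqP; split => x /= [X0x]; [have := iso_im X0x|]; tauto.
Qed.

Lemma mass_pull V : measurable V -> mass mu (X0 `&` phi @^-1` V) = mass nu V.
Proof.
move=> mV; have [_ [_ nY0] _ _ _ meas] := iso.
rewrite (_ : _ `&` _ = X0 `&` phi @^-1` (V `&` Y0)); last first.
  by apply/seteqP; split => x /= [X0x]; [have := iso_im X0x|]; tauto.
have mVY := measurableI _ _ mV mY0.
rewrite {1}/mass meas //.
rewrite -/(mass nu (V `&` Y0)); apply: dist0_mass => //.
apply: mass_negligible; first exact: measurable_setY.
apply: (@negligibleS _ _ _ _ (~` Y0)); first by move=> y /=; tauto.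
by apply/negligibleP => //; exact: measurableC.
Qed.

Lemma X0_pow z x : X0 x -> X0 (aut_pow T z x) /\ phi (aut_pow T z x) = aut_pow
  T0 z (phi x).
Proof.
have fwd y : X0 y -> X0 (T y) by move=> X0y; rewrite -TX0; exists y.
have bwd y : X0 y -> X0 (aut_inv T y).
  by rewrite -[in X0 y]TX0 => -[y' X0y' <-]; rewrite aut_funK.
have binv y : X0 y -> phi (aut_inv T y) = aut_inv T0 (phi y).
  move=> X0y; have := phiT (bwd _ X0y); rewrite aut_invK => ->.
  by rewrite aut_funK.
move=> X0x; elim/int_rect: z => [//|n [IH1 IH2]|n [IH1 IH2]].
  have -> : n.+1%:Z = n%:Z + 1 by lia.
  by rewrite !aut_powS; split; [exact: fwd|rewrite phiT // IH2].
have -> : - n.+1%:Z = - n%:Z - 1 by lia.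
by rewrite !aut_powB; split; [exact: bwd|rewrite binv // IH2].
Qed.

Lemma X0_powE z x : X0 (aut_pow T z x) <-> X0 x.
Proof.
split=> [h|/(X0_pow z)[]//]; rewrite -(aut_powK T z x).
by have [] := X0_pow (- z) h.
Qed.

Lemma tower_bases_pull q a B : tower_bases T0 q a B ->
  tower_bases T q a (fun n => X0 `&` phi @^-1` B n).
Proof.
move=> HB; split.
- by move=> n; apply: measurable_pull; exact: base_measurable HB n.
- move=> n x; split.
    move=> [X0x /= /(base_cut HB)[r rq Br]]; exists r => //.
    by have [h1 h2] := X0_pow (- (start q a n r)%:Z) X0x; split => //=; rewrite h2.
  move=> [r rq [/X0_powE X0x /= Br]]; split => //=; apply/(base_cut HB); exists r => //.
  by have [_ <-] := X0_pow (- (start q a n r)%:Z) X0x.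
- move=> n k x kh [X0x /= Bx] [_ /= Bk]; apply: (base_disjoint HB kh Bx).
  by have [_ <-] := X0_pow k%:Z X0x.
- move=> A e mA e0.
  have mAX : measurable (A `&` X0) by exact: measurableI.
  have [_ _ bij im _ _] := iso.
  have mD : measurable (phi @` (A `&` X0)) by apply: im => // x [].
  have [s sh sd] := base_dense HB mD e0; exists s => //; apply: le_lt_trans sd.
  set W := \big[setU/set0]_(p <- s) _; set V := \big[setU/set0]_(p <- s) _.
  have mV : measurable V.
    apply: bigsetU_measurable => p _.
    exact: measurable_pre (preserving_pow T0 _) (base_measurable HB _).
  have mW : measurable W.
    apply: bigsetU_measurable => p _.
    exact: measurable_pre (preserving_pow T _) (measurable_pull (base_measurable HB _)).
  have WV x : X0 x -> W x <-> V (phi x).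
    move=> X0x; rewrite /W /V -!bigcup_seq; split.
      move=> [p ps [_ /= Bp]]; exists p => //=.
      by have [_ <-] := X0_pow (- (p.2)%:Z) X0x.
    move=> [p ps /= Bp]; exists p => //=.
    by have [h1 h2] := X0_pow (- (p.2)%:Z) X0x; split => //=; rewrite h2.
  have mDV := measurable_setY mD mV.
  rewrite -[leRHS](mass_pull mDV); have mp := measurable_pull mDV.
  have mXC := measurableC mX0.
  rewrite -[leRHS]addr0 -(mass_negligible mXC negligible_isoC).
  apply: le_trans (mass_setU_le mu mp mXC); apply: le_mass.
  + exact: measurable_setY.
  + exact: measurableU.
  + move=> x AWx; have [X0x|] := pselect (X0 x); last by right.
    have DA : (phi @` (A `&` X0)) (phi x) <-> A x.
      split=> [[y [Ay X0y] e1]|Ax]; last by exists x.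
      by have [_ inj _] := bij; rewrite -(inj _ _ _ _ e1) ?inE.
    have WVx := WV x X0x; left; split => //.
    case: AWx => -[h1 h2]; [left|right]; split.
    * exact/DA.
    * by move=> /WVx.
    * exact/WVx.
    * by move=> /DA.
Qed.

Lemma coordinate_iso : coordinate mu X0 (fun x => val (phi x)).
Proof.
have [_ [_ nY0] bij im _ _] := iso; have [fun_ inj surj] := bij.
split.
- exact: mX0.
- have := mass_setC mu mX0; rewrite (mass_negligible (measurableC mX0) negligible_isoC).
  by move=> /esym/subr0_eq.
- by move=> x y X0x X0y /val_inj; apply: inj; rewrite inE.
- by move=> x _; exact: valP (phi x).
- by move=> t; apply: measurable_pull (measurable_unit_le t).
- by move=> t t01; apply: etrans (mass_pull (measurable_unit_le t)) (mass_unit_le t01).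
- move=> A e mA e0; have mAX : measurable (A `&` X0) by exact: measurableI.
  have mD : measurable (phi @` (A `&` X0)) by apply: im => // x [].
  have [l [r [lr cov sum]]] := unit_lebesgue_cover mD e0; exists l, r; split => //.
    by move=> x X0x Ax; apply: cov; exists x.
  move=> n; apply: le_trans (sum n) _; rewrite lerD2r -(mass_pull mD).
  apply: le_mass => //; first exact: measurable_pull.
  move=> x [X0x [y [Ay X0y] /= e1]].
  by rewrite -(inj _ _ _ _ e1) ?inE.
- move=> e e0; have [l [r [lr cov sum]]] := unit_lebesgue_cover (measurableC mY0) e0.
  exists l, r; split => //.
    move=> y y01 ny; apply: (cov (exist _ y y01)) => /surj[x X0x e1].
    by apply: ny; exists x => //; rewrite e1.
  move=> n; apply: le_trans (sum n) _.
  rewrite mass_negligible ?add0r //; first exact: measurableC.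
  by apply/negligibleP => //; exact: measurableC.
Qed.

End pullback.

Theorem theorem1p2 (R : realType) (d : measure_display) (X : measurableType d)
    (mu : probability X R) (T : mp_aut mu)
    (q : nat -> nat) (a : nat -> nat -> nat)
    (hX : lebesgue_space mu)
    (hT : rank_one T q a)
    (hb : bounded_parameters q a) :
  trivial_centralizer T <->
  exists k : nat, forall N : nat, exists n m i j : nat,
    [/\ (N <= n < N + k)%N, (N <= m < N + k)%N,
        (0 < i < q n)%N, (0 < j < q m)%N & a n i <> a m j].
Proof.
have [cmu _] := hX.
have [T0 [[q_gt1 _ [B0 [B' [C tow]]]] [X0 [Y0 [phi [iso TX0 phiT]]]]]] := hT.
have HB := tower_bases_pull iso TX0 phiT (tower_bases_towers q_gt1 tow).
have co := coordinate_iso iso.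
have cent (U : mp_aut mu) : centralizer T U <-> commuting T U.
  rewrite /centralizer /commuting /=; split; apply: negligibleS => x /= ne e1;
    apply: ne;
    by rewrite e1.
split.
- move=> triv; apply: contrapT => nk.
  have const k : exists N, ~ varying_spacers q a N k.
    apply: contrapT => nN; apply: nk; exists k => N.
    by apply: contrapT => nv; apply: nN; exists N.
  have [U cU nU] := nontrivial_centralizer HB q_gt1 const co cmu.
  have : powers T U by rewrite -triv; exact/cent.
  by move=> [z Uz]; apply: (nU z).
- move=> [k vary]; have [[M qM] [A aA]] := hb.
  have sep (S : mp_aut mu) z : (forall C, measurable C ->
      dist mu (S @^-1` C) (aut_pow T z @^-1` C) = 0) -> powers T S.
    move=> d0; exists z.
    exact: (ae_eq_of_dist co (preserving_fun S) (preserving_pow T z) d0).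
  apply/seteqP; split => S.
    move=> /cent cS.
    have [z d0] := centralizer_pow HB q_gt1 qM aA vary (preserving_fun S) cS.
    exact: sep d0.
  move=> [z nz]; apply/cent.
  (* Commutation can fail only where [S] differs from the power at [x] or at [T x]. *)
  apply: negligibleS (negligibleU nz (negligible_pre (preserving_fun T) nz)) => x /= ne.
  apply: contrapT => h; apply: ne.
  have e1 : S x = aut_pow T z x by apply: contrapT => ne; apply: h; left.
  have e2 : S (T x) = aut_pow T z (T x) by apply: contrapT => ne; apply: h; right.
  by rewrite e1 e2 -aut_powS aut_powD.
Qed.
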